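(* Let $\theta\in(0,\pi/2)$ be fixed. Then there is a number $\rho\in(0,1)$, depending on $\theta$ but not on $f$, with the following property. Let $f$ be a bounded analytic function in the slit disk $A_\pi$ that satisfies $f(z)=O(|z|^\delta)$ as $z\to 0$ for some $\delta>0$. Then there exist type $(n-1,n)$ rational functions $\{r_n\}$, $1\le n<\infty$, such that $$\|f-r_n\|_\Omega = O(e^{-C\sqrt n})$$ as $n\to\infty$ for some $C>0$, where $\Omega=\rho A_\theta$. Moreover, each $r_n$ can be taken to have simple poles only at $$\beta_j=-e^{-\sigma j/\sqrt n},\qquad 0\le j\le n-1,$$ where $\sigma>0$ is arbitrary (fixed independently of $n$; the constant $C$ may depend on $\sigma$).
   Context: For $0<\theta\le\pi$, $A_\theta=\{z\in\mathbb{C}:\ |z|<1,\ -\theta<\arg z<\theta\}$; in particular $A_\pi$ is the open unit disk slit along the negative real axis, i.e. with $(-1,0]$ removed. For $\rho>0$, $\rho A_\theta=\{\rho z:\ z\in A_\theta\}$. A rational function $r$ is of type $(m,n)$ if it can be written $r=p/q$ with $p,q$ polynomials of degrees $\le m$ and $\le n$, respectively. $\|\cdot\|_\Omega$ denotes the supremum norm over $\Omega$. *)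

(* Defs.v *)
From Stdlib Require Import Reals.
From Coquelicot Require Import Coquelicot.

Open Scope R_scope.

(* t is the principal argument of z; z = 0 has no argument. *)
Definition is_arg (z : C) (t : R) : Prop :=
  z <> RtoC 0 /\ - PI < t <= PI /\ z = (Cmod z * cos t, Cmod z * sin t).

Definition sector (theta : R) (z : C) : Prop :=
  Cmod z < 1 /\ exists t, is_arg z t /\ - theta < t < theta.

Definition scale_set (rho : R) (A : C -> Prop) (w : C) : Prop :=
  exists z, A z /\ w = (RtoC rho * z)%C.

Definition holomorphic_on (U : C -> Prop) (f : C -> C) : Prop :=
  forall z, U z -> ex_derive (K := C_AbsRing) (V := C_NormedModule) f z.

Definition bounded_on (U : C -> Prop) (f : C -> C) : Prop :=
  exists M, forall z, U z -> Cmod (f z) <= M.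

Definition bigO_pow_at_0 (U : C -> Prop) (f : C -> C) (delta : R) : Prop :=
  exists M, within U (locally (RtoC 0))
    (fun z => Cmod (f z) <= M * Rpower (Cmod z) delta).

Definition sup_norm (Omega : C -> Prop) (g : C -> C) : Rbar :=
  Lub_Rbar (fun x => exists z, Omega z /\ x = Cmod (g z)).

(* a 0 + a 1 z + ... + a m z^m; leading coefficients may vanish. *)
Definition poly (a : nat -> C) (m : nat) (z : C) : C :=
  sum_n (G := C_AbelianMonoid) (fun k => (a k * z ^ k)%C) m.

(* The values of r at the finitely many zeros of the denominator are left
   free; poles are therefore tested by punctured limits below. *)
Definition is_rational (m n : nat) (r : C -> C) : Prop :=
  exists a b : nat -> C,
    (exists z, poly b n z <> RtoC 0) /\
    (forall z, poly b n z <> RtoC 0 -> r z = (poly a m z / poly b n z)%C).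

Definition is_pole (r : C -> C) (w : C) : Prop :=
  filterlim (fun z => Cmod (r z)) (locally' w) (Rbar_locally p_infty).

Definition is_simple_pole (r : C -> C) (w : C) : Prop :=
  exists c : C, c <> RtoC 0 /\
    filterlim (fun z => ((z - w) * r z)%C) (locally' w) (locally c).

Definition simple_poles_only_in (S : C -> Prop) (r : C -> C) : Prop :=
  forall w, is_pole r w -> S w /\ is_simple_pole r w.

Definition beta (sigma : R) (n j : nat) : C :=
  RtoC (- exp (- (sigma * INR j / sqrt (INR n)))).

Definition root_exp_convergent
    (Omega : C -> Prop) (f : C -> C) (r : nat -> C -> C) : Prop :=
  exists c : R, 0 < c /\ exists M : R,
    eventually (fun n =>
      Rbar_le (sup_norm Omega (fun z => (f z - r n z)%C))
              (Finite (M * exp (- (c * sqrt (INR n)))))).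

(* Main.v *)
Require Import Defs.
From Stdlib Require Import Reals Lra Lia.
From Coquelicot Require Import Coquelicot.

(** The approximant is a discretised Cauchy integral whose kernel has been
    made rational.  Write alpha_j = - beta_j > 0 and
    Phi(z) = prod_j (z - alpha_j) / (z + alpha_j).  For each t the function
    (1 - Phi(z) / Phi(t)) / (t - z) is rational in z with poles at the beta_j
    only, and it differs from the Cauchy kernel 1 / (t - z) by the factor
    Phi(z) / Phi(t).  It splits as a finite sum of products E_j(z) D_j(t)
    ([malmquist_expansion]), so integrating it against f in t yields
    coefficients in front of the fixed rational functions E_j.

    The contour is the boundary of the circular sector of radius 1/2 and
    half-opening [psi] = 2 pi / 3 < pi.  On its two straight sides t lies in the
    left half-plane, where every factor of Phi has modulus at least 1, and the
    factors with alpha_j between |t|/2 and |t| have modulus bounded away from 1.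
    As log alpha_j is equally spaced with step sigma / sqrt n, about
    (ln 2) sqrt n / sigma of them do, whence |Phi(t)| >= exp(c sqrt n)
    ([Cmod_blaschke_on_ray]), while |Phi(z)| <= 1 for z in the right
    half-plane.  The parts of the sides with |t| < exp(-L), L ~ sqrt n, are
    dropped at a cost O(exp(-delta L)), because f(t) = O(|t|^delta).  On the
    arc |t| = 1/2 the ratio Phi(z) / Phi(t) is useless, but there |z/t| <= 1/2
    as soon as |z| <= 1/4, so the Cauchy kernel is replaced by a partial sum
    of its geometric series.  Half of the degree is spent on each part, and
    rho = 1/4 serves for every f, every sigma and every theta < pi / 2
    ([approximant_error], [root_approximant_bound]).

    Cauchy's formula is proved from scratch.  In the variable w = log t the
    contour becomes a rectangle, so Goursat's theorem for rectangles
    ([goursat_rectangle]) suffices; the formula follows by shrinking the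
    rectangle to a small square round log z ([rect_int_residue],
    [cauchy_formula_slit_disk]). *)

(** * Complex differentiation and the exponential *)

(** Differentiability towards [C_AbsRing] itself, so that the product and chain
    rules, which are stated for maps from a field to itself, apply. *)
Definition hol_at (f : C -> C) (p : C) : Prop :=
  ex_derive (K := C_AbsRing) (V := AbsRing_NormedModule C_AbsRing) f p.

Definition ccont {U : UniformSpace} (f : U -> C) (x : U) : Prop :=
  continuous (T := U) (U := AbsRing_UniformSpace C_AbsRing) f x.

Lemma holomorphic_on_hol_at (U : C -> Prop) (f : C -> C) (z : C) :
  holomorphic_on U f -> U z -> hol_at f z.
Proof.
  intros Hf Hz; destruct (Hf z Hz) as [l [[H1 H2 H3] H4]].
  exists l; split; [constructor|]; assumption.
Qed.

Lemma hol_at_expansion (f : C -> C) (p : C) :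
  hol_at f p ->
  exists l : C, forall eps : R, 0 < eps -> exists d : R, 0 < d /\
    forall w : C, Cmod (w - p) < d ->
      Cmod (f w - f p - l * (w - p)) <= eps * Cmod (w - p).
Proof.
  intros [l [_ H]]; exists l; intros eps Heps.
  destruct (H p (fun P HP => HP) (mkposreal eps Heps)) as [d Hd].
  exists (pos d); split; [apply cond_pos|].
  intros w Hw; specialize (Hd w Hw).
  change (Cmod (f w - f p - (w - p) * l) <= eps * Cmod (w - p)) in Hd.
  rewrite (Cmult_comm l); exact Hd.
Qed.

(** Both functions differentiated by hand below, the inverse and the
    exponential, have an explicit second-order remainder. *)
Lemma hol_at_of_quadratic (f : C -> C) (p l : C) (K r : R) :
  0 < r ->
  (forall w : C, Cmod (w - p) < r ->
     Cmod (f w - f p - l * (w - p)) <= K * Cmod (w - p) ^ 2) ->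
  hol_at f p.
Proof.
  intros Hr H; exists l; split; [apply is_linear_scal_l|].
  intros x Hx.
  pose proof (is_filter_lim_locally_unique (K := C_AbsRing)
    (V := AbsRing_NormedModule C_AbsRing) p x Hx); subst x.
  intros [eps Heps].
  assert (HK : 0 < Rabs K + 1) by (pose proof (Rabs_pos K); lra).
  assert (Hd : 0 < Rmin r (eps / (Rabs K + 1))).
  { apply Rmin_pos; [assumption|]. apply Rdiv_lt_0_compat; lra. }
  exists (mkposreal _ Hd); intros w Hw.
  change (Cmod (w - p) < Rmin r (eps / (Rabs K + 1))) in Hw.
  change (Cmod (f w - f p - (w - p) * l) <= eps * Cmod (w - p)).
  rewrite (Cmult_comm _ l).
  assert (H1 : Cmod (w - p) < r) by (eapply Rlt_le_trans; [exact Hw|apply Rmin_l]).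
  assert (H2 : Cmod (w - p) < eps / (Rabs K + 1))
    by (eapply Rlt_le_trans; [exact Hw|apply Rmin_r]).
  eapply Rle_trans; [apply H, H1|].
  pose proof (Cmod_ge_0 (w - p)) as H0.
  replace (K * Cmod (w - p) ^ 2) with ((K * Cmod (w - p)) * Cmod (w - p)) by ring.
  apply Rmult_le_compat_r; [assumption|].
  apply Rle_trans with ((Rabs K + 1) * (eps / (Rabs K + 1))).
  - apply Rle_trans with (Rabs K * Cmod (w - p)).
    + apply Rmult_le_compat_r; [assumption|apply Rle_abs].
    + pose proof (Rabs_pos K).
      apply Rmult_le_compat; lra.
  - right; field; lra.
Qed.

Lemma hol_at_ccont (f : C -> C) (p : C) :
  hol_at f p -> ccont (U := AbsRing_UniformSpace C_AbsRing) f p.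
Proof.
  intros H.
  exact (ex_derive_continuous (K := C_AbsRing)
           (V := AbsRing_NormedModule C_AbsRing) f p H).
Qed.

Lemma hol_at_const (c p : C) : hol_at (fun _ => c) p.
Proof. apply (ex_derive_const (K := C_AbsRing) (V := AbsRing_NormedModule C_AbsRing)). Qed.

Lemma hol_at_id (p : C) : hol_at (fun w => w) p.
Proof. apply (ex_derive_id (K := C_AbsRing)). Qed.

Lemma hol_at_plus (f g : C -> C) (p : C) :
  hol_at f p -> hol_at g p -> hol_at (fun w => f w + g w)%C p.
Proof.
  intros Hf Hg.
  exact (ex_derive_plus (K := C_AbsRing) (V := AbsRing_NormedModule C_AbsRing)
           f g p Hf Hg).
Qed.

Lemma hol_at_minus (f g : C -> C) (p : C) :
  hol_at f p -> hol_at g p -> hol_at (fun w => f w - g w)%C p.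
Proof.
  intros Hf Hg.
  exact (ex_derive_minus (K := C_AbsRing) (V := AbsRing_NormedModule C_AbsRing)
           f g p Hf Hg).
Qed.

Lemma hol_at_mult (f g : C -> C) (p : C) :
  hol_at f p -> hol_at g p -> hol_at (fun w => f w * g w)%C p.
Proof.
  intros [df Hf] [dg Hg]; eexists.
  exact (is_derive_mult (K := C_AbsRing) f g p df dg Hf Hg Cmult_comm).
Qed.

Lemma hol_at_comp (f g : C -> C) (p : C) :
  hol_at f (g p) -> hol_at g p -> hol_at (fun w => f (g w)) p.
Proof.
  intros Hf Hg.
  exact (ex_derive_comp (K := C_AbsRing) (V := AbsRing_NormedModule C_AbsRing)
           f g p Hf Hg).
Qed.

Lemma Cmod_lower (w p : C) (d : R) : Cmod (w - p) <= d -> Cmod p - d <= Cmod w.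
Proof.
  intros H.
  pose proof (Cmod_triangle w (- (w - p))) as Ht.
  rewrite Cmod_opp in Ht.
  replace (w + - (w - p))%C with p in Ht by ring; lra.
Qed.

Lemma hol_at_Cinv (p : C) : p <> RtoC 0 -> hol_at Cinv p.
Proof.
  intros Hp.
  assert (H0 : 0 < Cmod p) by (apply Cmod_gt_0; exact Hp).
  apply (hol_at_of_quadratic _ _ (- / (p * p)) (2 / Cmod p ^ 3) (Cmod p / 2)); [lra|].
  intros w Hw.
  pose proof (Cmod_lower w p (Cmod p / 2) ltac:(lra)) as Hl.
  assert (Hw0 : w <> RtoC 0) by (apply Cmod_gt_0; lra).
  replace (/ w - / p - - / (p * p) * (w - p))%C
    with ((w - p) * (w - p) / (w * (p * p)))%C by (field; auto).
  rewrite Cmod_div by (repeat apply Cmult_neq_0; assumption).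
  rewrite !Cmod_mult.
  pose proof (Cmod_ge_0 (w - p)) as H1.
  set (u := Cmod (w - p)) in *; set (v := Cmod w) in *; set (q := Cmod p) in *.
  apply Rle_trans with (u * u / ((q / 2) * (q * q))).
  - apply Rmult_le_compat_l; [nra|].
    apply Rinv_le_contravar; [repeat apply Rmult_lt_0_compat; lra|].
    apply Rmult_le_compat_r; [apply Rmult_le_pos|]; lra.
  - right; field; lra.
Qed.

Lemma hol_at_div (f g : C -> C) (p : C) :
  hol_at f p -> hol_at g p -> g p <> RtoC 0 -> hol_at (fun w => f w / g w)%C p.
Proof.
  intros Hf Hg H0; apply hol_at_mult; [exact Hf|].
  apply (hol_at_comp Cinv g); [apply hol_at_Cinv, H0|exact Hg].
Qed.

Definition cexp (w : C) : C := (exp (fst w) * cos (snd w), exp (fst w) * sin (snd w)).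

Lemma cexp_plus (v w : C) : cexp (v + w) = (cexp v * cexp w)%C.
Proof.
  unfold cexp, Cmult, Cplus; simpl.
  rewrite exp_plus, cos_plus, sin_plus; f_equal; ring.
Qed.

Lemma Cmod_cexp (w : C) : Cmod (cexp w) = exp (fst w).
Proof.
  unfold cexp, Cmod; simpl fst; simpl snd.
  replace (_ + _) with (Rsqr (exp (fst w)) * (Rsqr (sin (snd w)) + Rsqr (cos (snd w))))
    by (unfold Rsqr; ring).
  rewrite sin2_cos2, Rmult_1_r.
  apply sqrt_Rsqr, Rlt_le, exp_pos.
Qed.

Lemma cexp_neq_0 (w : C) : cexp w <> RtoC 0.
Proof. apply Cmod_gt_0; rewrite Cmod_cexp; apply exp_pos. Qed.

Lemma Cmod_le_sum (w : C) : Cmod w <= Rabs (fst w) + Rabs (snd w).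
Proof.
  unfold Cmod; apply Rsqr_incr_0_var.
  - rewrite Rsqr_sqrt by nra; unfold Rsqr.
    pose proof (Rabs_pos (fst w)); pose proof (Rabs_pos (snd w)).
    rewrite <- (pow2_abs (fst w)), <- (pow2_abs (snd w)); nra.
  - pose proof (Rabs_pos (fst w)); pose proof (Rabs_pos (snd w)); lra.
Qed.

Lemma Rabs_fst_le (w : C) : Rabs (fst w) <= Cmod w.
Proof. eapply Rle_trans; [apply Rmax_l|apply Rmax_Cmod]. Qed.

Lemma Rabs_snd_le (w : C) : Rabs (snd w) <= Cmod w.
Proof. eapply Rle_trans; [apply Rmax_r|apply Rmax_Cmod]. Qed.

Lemma cos_quadratic (b : R) : 0 <= 1 - cos b <= b ^ 2.
Proof.
  pose proof (COS_bound b).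
  split; [lra|].
  replace b with (2 * (b / 2)) at 1 by field.
  rewrite cos_2a_sin.
  assert (Rabs (sin (b / 2)) <= Rabs (b / 2)).
  { destruct (Rle_dec 0 (b / 2)).
    - destruct (Req_dec (b/2) 0) as [->|]; [rewrite sin_0; lra|].
      pose proof (sin_lt_x (b / 2) ltac:(lra)).
      rewrite (Rabs_right (b / 2)) by lra.
      apply Rabs_le; split; [|lra].
      destruct (Rle_dec (b/2) PI).
      + pose proof (sin_ge_0 (b / 2) ltac:(lra) ltac:(lra)); lra.
      + pose proof (SIN_bound (b / 2)); pose proof PI2_3_2; pose proof PI_RGT_0; lra.
    - pose proof (sin_lt_x (- (b / 2)) ltac:(lra)) as H1.
      rewrite sin_neg in H1.
      rewrite (Rabs_left (b / 2)) by lra.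
      apply Rabs_le; split; [lra|].
      destruct (Rle_dec (- (b/2)) PI).
      + pose proof (sin_ge_0 (- (b / 2)) ltac:(lra) ltac:(lra)) as H2.
        rewrite sin_neg in H2; lra.
      + pose proof (SIN_bound (b / 2)); pose proof PI2_3_2; pose proof PI_RGT_0; lra. }
  pose proof (Rsqr_le_abs_1 _ _ H0) as H2; unfold Rsqr in H2; nra.
Qed.

Lemma sin_quadratic (b : R) : Rabs b <= 1 -> Rabs (sin b - b) <= b ^ 2.
Proof.
  intros Hb.
  destruct (MVT_gen (fun x => sin x - x) 0 b (fun x => cos x - 1)) as [c [Hc1 Hc2]].
  - intros x _; auto_derive; [exact I|ring].
  - intros x _.
    apply (continuity_pt_minus sin (fun y => y)); [apply continuity_sin|].
    apply derivable_continuous_pt, derivable_pt_id.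
  - rewrite sin_0 in Hc2.
    replace (sin b - b) with ((cos c - 1) * b) by lra.
    rewrite Rabs_mult.
    pose proof (cos_quadratic c) as [H1 H2].
    rewrite (Rabs_left1 (cos c - 1)) by lra.
    assert (Hcb : c ^ 2 <= b ^ 2).
    { rewrite <- (pow2_abs c), <- (pow2_abs b); apply pow_incr; split; [apply Rabs_pos|].
      unfold Rmin, Rmax in Hc1; destruct (Rle_dec 0 b).
      - rewrite !Rabs_right; lra.
      - rewrite !Rabs_left1; lra. }
    pose proof (Rabs_pos b); pose proof (pow2_ge_0 b).
    apply Rle_trans with (b ^ 2 * 1); [|lra].
    apply Rmult_le_compat; lra.
Qed.

Lemma exp_quadratic (a : R) : Rabs a <= 1 / 2 -> 0 <= exp a - 1 - a <= 2 * a ^ 2.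
Proof.
  intros Ha; apply Rabs_le_between in Ha.
  pose proof (exp_ineq1_le a); split; [lra|].
  assert (H1 : exp a * (1 - a) <= 1).
  { pose proof (exp_ineq1_le (- a)) as H1.
    apply Rle_trans with (exp a * exp (- a)).
    - apply Rmult_le_compat_l; [apply Rlt_le, exp_pos|lra].
    - rewrite <- exp_plus, Rplus_opp_r, exp_0; lra. }
  assert (H2 : (exp a - 1 - a) * (1 - a) <= a ^ 2) by nra.
  nra.
Qed.

Lemma cexp_quadratic (h : C) :
  Cmod h <= 1 / 2 -> Cmod (cexp h - 1 - h) <= 8 * Cmod h ^ 2.
Proof.
  intros Hh; destruct h as [a b].
  pose proof (Rabs_fst_le (a, b)) as Ha; pose proof (Rabs_snd_le (a, b)) as Hb.
  simpl fst in Ha; simpl snd in Hb.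
  set (m := Cmod (a, b)) in *.
  pose proof (exp_quadratic a ltac:(lra)) as He.
  pose proof (cos_quadratic b) as Hc.
  pose proof (sin_quadratic b ltac:(lra)) as Hs.
  assert (Ha2 : a ^ 2 <= m ^ 2).
  { rewrite <- (pow2_abs a); apply pow_incr; split; [apply Rabs_pos|lra]. }
  assert (Hb2 : b ^ 2 <= m ^ 2).
  { rewrite <- (pow2_abs b); apply pow_incr; split; [apply Rabs_pos|lra]. }
  assert (Hea : 0 < exp a <= 2).
  { split; [apply exp_pos|]. apply Rabs_le_between in Ha.
    assert (a^2 <= 1/4) by nra. lra. }
  eapply Rle_trans; [apply Cmod_le_sum|].
  unfold cexp; simpl fst; simpl snd.
  replace (exp a * cos b + - (1) + - a)
    with (- (exp a * (1 - cos b)) + (exp a - 1 - a)) by ring.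
  replace (exp a * sin b + - 0 + - b)
    with (exp a * (sin b - b) + (exp a - 1) * b) by ring.
  assert (H1 : Rabs (- (exp a * (1 - cos b)) + (exp a - 1 - a)) <= 2 * m ^ 2).
  { apply Rabs_le; split; nra. }
  assert (H2 : Rabs (exp a * (sin b - b)) <= 2 * m ^ 2).
  { rewrite Rabs_mult, (Rabs_right (exp a)) by lra.
    apply Rmult_le_compat; try lra; apply Rabs_pos. }
  assert (H3 : Rabs ((exp a - 1) * b) <= 2 * m ^ 2).
  { rewrite Rabs_mult.
    replace (2 * m ^ 2) with ((2 * m) * m) by ring.
    apply Rmult_le_compat; try apply Rabs_pos; try lra.
    apply Rabs_le_between in Ha.
    assert (a ^ 2 <= m / 2) by nra.
    apply Rabs_le; lra. }
  pose proof (Rabs_triang (exp a * (sin b - b)) ((exp a - 1) * b)).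
  pose proof (pow2_ge_0 m); lra.
Qed.

Lemma hol_at_cexp (p : C) : hol_at cexp p.
Proof.
  apply (hol_at_of_quadratic _ _ (cexp p) (Cmod (cexp p) * 8) (1 / 2)); [lra|].
  intros w Hw.
  replace w with (p + (w - p))%C at 1 by ring.
  rewrite cexp_plus.
  replace (cexp p * cexp (w - p) - cexp p - cexp p * (w - p))%C
    with (cexp p * (cexp (w - p) - 1 - (w - p)))%C by ring.
  rewrite Cmod_mult, Rmult_assoc.
  apply Rmult_le_compat_l; [apply Cmod_ge_0|].
  apply cexp_quadratic; lra.
Qed.

(** * Goursat's theorem for rectangles *)

Definition ex_CInt (g : R -> C) (a b : R) : Prop :=
  ex_RInt (V := C_R_CompleteNormedModule) g a b.

Definition CInt (g : R -> C) (a b : R) : C :=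
  RInt (V := C_R_CompleteNormedModule) g a b.

Lemma norm_C_R (z : C) : norm (V := C_R_CompleteNormedModule) z = Cmod z.
Proof. rewrite Cmod_norm; reflexivity. Qed.

Lemma ex_CInt_ccont (g : R -> C) (a b : R) :
  a <= b -> (forall x, a <= x <= b -> ccont (U := R_UniformSpace) g x) ->
  ex_CInt g a b.
Proof.
  intros Hab H; apply (ex_RInt_continuous (V := C_R_CompleteNormedModule)).
  rewrite Rmin_left, Rmax_right by assumption.
  intros x Hx P HP; apply (H x Hx), locally_C, HP.
Qed.

Lemma Cmod_CInt_le (g : R -> C) (a b M : R) :
  a <= b -> ex_CInt g a b -> (forall x, a <= x <= b -> Cmod (g x) <= M) ->
  Cmod (CInt g a b) <= (b - a) * M.
Proof.
  intros Hab Hg HM; rewrite <- norm_C_R.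
  apply (norm_RInt_le_const (V := C_R_CompleteNormedModule) g a b _ M Hab).
  - intros x Hx; rewrite norm_C_R; exact (HM x Hx).
  - exact (RInt_correct (V := C_R_CompleteNormedModule) g a b Hg).
Qed.

Lemma CInt_ext (f g : R -> C) (a b : R) :
  a <= b -> (forall x, a < x < b -> f x = g x) -> CInt f a b = CInt g a b.
Proof.
  intros Hab H; apply (RInt_ext (V := C_R_CompleteNormedModule)).
  rewrite Rmin_left, Rmax_right by assumption; exact H.
Qed.

Lemma CInt_plus (f g : R -> C) (a b : R) :
  ex_CInt f a b -> ex_CInt g a b ->
  CInt (fun x => f x + g x)%C a b = (CInt f a b + CInt g a b)%C.
Proof. exact (RInt_plus (V := C_R_CompleteNormedModule) f g a b). Qed.

Lemma CInt_minus (f g : R -> C) (a b : R) :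
  ex_CInt f a b -> ex_CInt g a b ->
  CInt (fun x => f x - g x)%C a b = (CInt f a b - CInt g a b)%C.
Proof. exact (RInt_minus (V := C_R_CompleteNormedModule) f g a b). Qed.

Lemma CInt_Chasles (g : R -> C) (a m b : R) :
  ex_CInt g a m -> ex_CInt g m b -> (CInt g a m + CInt g m b)%C = CInt g a b.
Proof. exact (RInt_Chasles (V := C_R_CompleteNormedModule) g a m b). Qed.

Lemma CInt_const (c : C) (a b : R) : CInt (fun _ => c) a b = (RtoC (b - a) * c)%C.
Proof.
  unfold CInt; rewrite (RInt_const (V := C_R_CompleteNormedModule)).
  destruct c; unfold scal; simpl; unfold prod_scal, scal; simpl; unfold mult; simpl.
  unfold Cmult, RtoC; simpl; f_equal; ring.
Qed.

Lemma is_CInt_Cmult (c : C) (g : R -> C) (a b : R) (I : C) :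
  is_RInt (V := C_R_CompleteNormedModule) g a b I ->
  is_RInt (V := C_R_CompleteNormedModule) (fun x => c * g x)%C a b (c * I)%C.
Proof.
  intros H.
  pose proof (is_RInt_fct_extend_fst (U := R_NormedModule) (V := R_NormedModule) g a b I H) as H1.
  pose proof (is_RInt_fct_extend_snd (U := R_NormedModule) (V := R_NormedModule) g a b I H) as H2.
  apply (is_RInt_fct_extend_pair (U := R_NormedModule) (V := R_NormedModule)).
  - apply (is_RInt_minus (V := R_NormedModule) (fun t => fst c * fst (g t))
             (fun t => snd c * snd (g t))); apply (is_RInt_scal (V := R_NormedModule)); assumption.
  - apply (is_RInt_plus (V := R_NormedModule) (fun t => fst c * snd (g t))
             (fun t => snd c * fst (g t))); apply (is_RInt_scal (V := R_NormedModule)); assumption.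
Qed.

Lemma ex_CInt_Cmult (c : C) (g : R -> C) (a b : R) :
  ex_CInt g a b -> ex_CInt (fun x => c * g x)%C a b.
Proof. intros [I H]; exists (c * I)%C; apply is_CInt_Cmult, H. Qed.

Lemma CInt_Cmult (c : C) (g : R -> C) (a b : R) :
  ex_CInt g a b -> CInt (fun x => c * g x)%C a b = (c * CInt g a b)%C.
Proof.
  intros H; apply (is_RInt_unique (V := C_R_CompleteNormedModule)).
  apply is_CInt_Cmult, (RInt_correct (V := C_R_CompleteNormedModule)), H.
Qed.

Lemma ccont_horizontal (F : C -> C) (x y : R) :
  ccont (U := AbsRing_UniformSpace C_AbsRing) F (x, y) ->
  ccont (U := R_UniformSpace) (fun s => F (s, y)) x.
Proof.
  intros H.
  apply (continuous_comp (U := R_UniformSpace) (V := AbsRing_UniformSpace C_AbsRing)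
           (W := AbsRing_UniformSpace C_AbsRing)
           (fun s => (s, y) : C) F x); [|exact H].
  intros P [eps HP]; exists eps; intros s Hs; apply HP.
  change (Cmod ((s, y) - (x, y))%C < eps).
  replace ((s, y) - (x, y))%C with (RtoC (s - x))
    by (unfold RtoC, Cminus, Cplus, Copp; simpl; f_equal; ring).
  rewrite Cmod_R; exact Hs.
Qed.

Lemma ccont_vertical (F : C -> C) (x y : R) :
  ccont (U := AbsRing_UniformSpace C_AbsRing) F (x, y) ->
  ccont (U := R_UniformSpace) (fun s => F (x, s)) y.
Proof.
  intros H.
  apply (continuous_comp (U := R_UniformSpace) (V := AbsRing_UniformSpace C_AbsRing)
           (W := AbsRing_UniformSpace C_AbsRing)
           (fun s => (x, s) : C) F y); [|exact H].
  intros P [eps HP]; exists eps; intros s Hs; apply HP.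
  change (Cmod ((x, s) - (x, y))%C < eps).
  replace ((x, s) - (x, y))%C with (Ci * RtoC (s - y))%C
    by (unfold RtoC, Ci, Cmult, Cminus, Cplus, Copp; simpl; f_equal; ring).
  rewrite Cmod_mult, Cmod_Ci, Cmod_R, Rmult_1_l; exact Hs.
Qed.

Lemma ex_CInt_horizontal (F : C -> C) (a b y : R) :
  a <= b -> (forall x, a <= x <= b -> hol_at F (x, y)) ->
  ex_CInt (fun x => F (x, y)) a b.
Proof.
  intros Hab H; apply ex_CInt_ccont; [exact Hab|].
  intros x Hx; apply ccont_horizontal, hol_at_ccont, H, Hx.
Qed.

Lemma ex_CInt_vertical (F : C -> C) (c d x : R) :
  c <= d -> (forall y, c <= y <= d -> hol_at F (x, y)) ->
  ex_CInt (fun y => F (x, y)) c d.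
Proof.
  intros Hcd H; apply ex_CInt_ccont; [exact Hcd|].
  intros y Hy; apply ccont_vertical, hol_at_ccont, H, Hy.
Qed.

Lemma ex_CInt_minus (f g : R -> C) (a b : R) :
  ex_CInt f a b -> ex_CInt g a b -> ex_CInt (fun x => f x - g x)%C a b.
Proof. exact (ex_RInt_minus (V := C_R_CompleteNormedModule) f g a b). Qed.

(** Opposite sides are integrated together: the difference of an affine function
    across the rectangle is constant, so that affine functions are seen to have
    zero integral without integrating anything but constants. *)
Definition rect_int (F : C -> C) (a b c d : R) : C :=
  (CInt (fun x => F (x, c) - F (x, d))%C a b
   + Ci * CInt (fun y => F (b, y) - F (a, y))%C c d)%C.

Definition on_edges (F : C -> C) (a b c d : R) : Prop :=
  (forall x, a <= x <= b -> hol_at F (x, c) /\ hol_at F (x, d)) /\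
  (forall y, c <= y <= d -> hol_at F (a, y) /\ hol_at F (b, y)).

Lemma rect_int_split_x (F : C -> C) (a m b c d : R) :
  a <= m <= b -> c <= d -> on_edges F a m c d -> on_edges F m b c d ->
  rect_int F a b c d = (rect_int F a m c d + rect_int F m b c d)%C.
Proof.
  intros Hm Hcd [H1 H2] [H3 H4]; unfold rect_int.
  rewrite <- (CInt_Chasles _ a m b).
  2, 3: apply ex_CInt_minus; apply ex_CInt_horizontal; try lra;
        intros x Hx; (apply H1 + apply H3); exact Hx.
  assert (E1 : ex_CInt (fun y => F (a, y)) c d)
    by (apply ex_CInt_vertical; [lra|]; apply H2).
  assert (E2 : ex_CInt (fun y => F (m, y)) c d)
    by (apply ex_CInt_vertical; [lra|]; apply H2).
  assert (E3 : ex_CInt (fun y => F (b, y)) c d)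
    by (apply ex_CInt_vertical; [lra|]; apply H4).
  rewrite (CInt_minus (fun y => F (b, y)) (fun y => F (a, y))) by assumption.
  rewrite (CInt_minus (fun y => F (m, y)) (fun y => F (a, y))) by assumption.
  rewrite (CInt_minus (fun y => F (b, y)) (fun y => F (m, y))) by assumption.
  ring.
Qed.

Lemma rect_int_split_y (F : C -> C) (a b c m d : R) :
  a <= b -> c <= m <= d -> on_edges F a b c m -> on_edges F a b m d ->
  rect_int F a b c d = (rect_int F a b c m + rect_int F a b m d)%C.
Proof.
  intros Hab Hm [H1 H2] [H3 H4]; unfold rect_int.
  rewrite <- (CInt_Chasles _ c m d).
  2, 3: apply ex_CInt_minus; apply ex_CInt_vertical; try lra;
        intros x Hx; (apply H2 + apply H4); exact Hx.
  assert (E1 : ex_CInt (fun x => F (x, c)) a b)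
    by (apply ex_CInt_horizontal; [lra|]; apply H1).
  assert (E2 : ex_CInt (fun x => F (x, m)) a b)
    by (apply ex_CInt_horizontal; [lra|]; apply H1).
  assert (E3 : ex_CInt (fun x => F (x, d)) a b)
    by (apply ex_CInt_horizontal; [lra|]; apply H3).
  rewrite (CInt_minus (fun x => F (x, c)) (fun x => F (x, d))) by assumption.
  rewrite (CInt_minus (fun x => F (x, c)) (fun x => F (x, m))) by assumption.
  rewrite (CInt_minus (fun x => F (x, m)) (fun x => F (x, d))) by assumption.
  ring.
Qed.

(** Subtracting an affine function does not change the integral, since its
    contributions from the two pairs of sides cancel. *)
Lemma rect_int_le (F : C -> C) (a b c d e : R) (k l : C) :
  a <= b -> c <= d -> on_edges F a b c d ->
  (forall x, a <= x <= b -> Cmod (F (x, c) - (k + l * (x, c))) <= e /\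
                            Cmod (F (x, d) - (k + l * (x, d))) <= e) ->
  (forall y, c <= y <= d -> Cmod (F (a, y) - (k + l * (a, y))) <= e /\
                            Cmod (F (b, y) - (k + l * (b, y))) <= e) ->
  Cmod (rect_int F a b c d) <= 2 * e * ((b - a) + (d - c)).
Proof.
  intros Hab Hcd [H1 H2] He1 He2; unfold rect_int.
  set (g1 := fun x => (F (x, c) - F (x, d))%C).
  set (g2 := fun y => (F (b, y) - F (a, y))%C).
  assert (E1 : ex_CInt g1 a b)
    by (apply ex_CInt_minus; apply ex_CInt_horizontal; try lra; apply H1).
  assert (E2 : ex_CInt g2 c d)
    by (apply ex_CInt_minus; apply ex_CInt_vertical; try lra; apply H2).
  set (k1 := (l * (Ci * RtoC (c - d)))%C); set (k2 := (l * RtoC (b - a))%C).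
  assert (Ek : forall (k : C) u v, ex_CInt (fun _ => k) u v)
    by (intros k' u v; apply (ex_RInt_const (V := C_R_CompleteNormedModule))).
  replace (CInt g1 a b + Ci * CInt g2 c d)%C
    with (CInt (fun x => g1 x - k1) a b + Ci * CInt (fun y => g2 y - k2) c d)%C.
  2: { rewrite !CInt_minus by auto.
       rewrite !CInt_const; unfold k1, k2; rewrite !RtoC_minus; ring. }
  eapply Rle_trans; [apply Cmod_triangle|].
  rewrite Cmod_mult, Cmod_Ci, Rmult_1_l.
  assert (I1 : Cmod (CInt (fun x => g1 x - k1)%C a b) <= (b - a) * (2 * e)).
  { apply Cmod_CInt_le; [lra|apply ex_CInt_minus; auto|].
    intros x Hx.
    replace (g1 x - k1)%C with
      ((F (x, c) - (k + l * (x, c))) + - (F (x, d) - (k + l * (x, d))))%C.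
    - eapply Rle_trans; [apply Cmod_triangle|]; rewrite Cmod_opp.
      destruct (He1 x Hx); lra.
    - replace (x, d) with ((x, c) - Ci * RtoC (c - d))%C at 2
        by (unfold Ci, RtoC, Cminus, Cplus, Copp, Cmult; simpl; f_equal; ring).
      unfold g1, k1; ring. }
  assert (I2 : Cmod (CInt (fun y => g2 y - k2)%C c d) <= (d - c) * (2 * e)).
  { apply Cmod_CInt_le; [lra|apply ex_CInt_minus; auto|].
    intros y Hy.
    replace (g2 y - k2)%C with
      ((F (b, y) - (k + l * (b, y))) + - (F (a, y) - (k + l * (a, y))))%C.
    - eapply Rle_trans; [apply Cmod_triangle|]; rewrite Cmod_opp.
      destruct (He2 y Hy); lra.
    - replace (a, y) with ((b, y) - RtoC (b - a))%C at 2
        by (unfold RtoC, Cminus, Cplus, Copp; simpl; f_equal; ring).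
      unfold g2, k2; ring. }
  lra.
Qed.

Lemma nested_dyadic_intervals (u : nat -> R) (A : R) :
  0 <= A -> (forall n, u n <= u (S n) <= u n + A / 2 ^ S n) ->
  exists x, forall n, u n <= x <= u n + A / 2 ^ n.
Proof.
  intros HA H.
  assert (Hp : forall n, 0 < 2 ^ n) by (intros n; apply pow_lt; lra).
  assert (Hstep : forall n, u (S n) + A / 2 ^ S n <= u n + A / 2 ^ n).
  { intros n; pose proof (H n).
    replace (A / 2 ^ n) with (A / 2 ^ S n + A / 2 ^ S n); [lra|].
    simpl; field; specialize (Hp n); lra. }
  assert (Hinc : forall n k, u n <= u (n + k)%nat /\
                  u (n + k)%nat + A / 2 ^ (n + k) <= u n + A / 2 ^ n).
  { intros n; induction k as [|k IH].
    - rewrite Nat.add_0_r; lra.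
    - rewrite Nat.add_succ_r; pose proof (H (n + k)%nat); pose proof (Hstep (n + k)%nat); lra. }
  assert (Hpos : forall n, 0 <= A / 2 ^ n)
    by (intros n; apply Rdiv_le_0_compat; [exact HA|apply Hp]).
  assert (Hcross : forall m n, u m <= u n + A / 2 ^ n).
  { intros m n; destruct (Nat.le_ge_cases n m) as [h|h].
    - pose proof (Hinc n (m - n)%nat) as H1.
      replace (n + (m - n))%nat with m in H1 by lia.
      pose proof (Hpos m); lra.
    - pose proof (Hinc m (n - m)%nat) as H1.
      replace (m + (n - m))%nat with n in H1 by lia.
      pose proof (Hpos n); lra. }
  destruct (completeness (fun x => exists m, x = u m)) as [x [Hub Hlub]].
  - exists (u 0%nat + A / 2 ^ 0); intros y [m ->]; apply Hcross.
  - exists (u 0%nat); exists 0%nat; reflexivity.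
  - exists x; intros n; split.
    + apply Hub; exists n; reflexivity.
    + apply Hlub; intros y [m ->]; apply Hcross.
Qed.

Section GoursatBisection.
Variables (F : C -> C) (a b c d : R).
Hypotheses (Hab : a <= b) (Hcd : c <= d).
Hypothesis HF : forall x y, a <= x <= b -> c <= y <= d -> hol_at F (x, y).

Let width (n : nat) : R := (b - a) / 2 ^ n.
Let height (n : nat) : R := (d - c) / 2 ^ n.
Let cell (n : nat) (p : R * R) : C :=
  rect_int F (fst p) (fst p + width n) (snd p) (snd p + height n).
Let inside (n : nat) (p : R * R) : Prop :=
  a <= fst p /\ fst p + width n <= b /\ c <= snd p /\ snd p + height n <= d.

Lemma width_half n : width n = width (S n) + width (S n).
Proof. unfold width; simpl; field; apply pow_nonzero; lra. Qed.
Lemma height_half n : height n = height (S n) + height (S n).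
Proof. unfold height; simpl; field; apply pow_nonzero; lra. Qed.
Lemma width_pos n : 0 <= width n.
Proof. apply Rdiv_le_0_compat; [lra|apply pow_lt; lra]. Qed.
Lemma height_pos n : 0 <= height n.
Proof. apply Rdiv_le_0_compat; [lra|apply pow_lt; lra]. Qed.

Lemma cell_split n p :
  inside n p ->
  cell n p = (cell (S n) p + cell (S n) ((fst p + width (S n))%R, snd p)
    + (cell (S n) (fst p, (snd p + height (S n))%R)
       + cell (S n) ((fst p + width (S n))%R, (snd p + height (S n))%R)))%C.
Proof.
  intros [H1 [H2 [H3 H4]]]; unfold cell; simpl.
  rewrite (width_half n), (height_half n) in *.
  pose proof (width_pos (S n)); pose proof (height_pos (S n)).
  rewrite <- !Rplus_assoc in *.
  set (x0 := fst p) in *; set (y0 := snd p) in *.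
  set (w := width (S n)) in *; set (h := height (S n)) in *.
  assert (HE : forall a' b' c' d', a <= a' -> b' <= b -> a' <= b' ->
            c <= c' -> d' <= d -> c' <= d' -> on_edges F a' b' c' d').
  { intros; split; intros; split; apply HF; lra. }
  rewrite (rect_int_split_y F x0 (x0 + w + w) y0 (y0 + h) (y0 + h + h))
    by (lra || (apply HE; lra)).
  rewrite (rect_int_split_x F x0 (x0 + w) (x0 + w + w) y0 (y0 + h))
    by (lra || (apply HE; lra)).
  rewrite (rect_int_split_x F x0 (x0 + w) (x0 + w + w) (y0 + h) (y0 + h + h))
    by (lra || (apply HE; lra)).
  reflexivity.
Qed.

(** The integral over a cell is the sum of those over its quarters, so one quarter
    carries at least a fourth of it in modulus. *)
Lemma bad_quarter n p :
  {q : R * R | inside n p -> inside (S n) q /\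
     fst p <= fst q <= fst p + width (S n) /\
     snd p <= snd q <= snd p + height (S n) /\
     Cmod (cell n p) <= 4 * Cmod (cell (S n) q)}.
Proof.
  pose proof (width_pos (S n)); pose proof (height_pos (S n)).
  pose proof (width_half n); pose proof (height_half n).
  destruct (Rle_dec (Cmod (cell n p)) (4 * Cmod (cell (S n) p))) as [h1|h1].
  { exists p; intros [? [? [? ?]]]; unfold inside; simpl; repeat split; lra. }
  destruct (Rle_dec (Cmod (cell n p))
    (4 * Cmod (cell (S n) ((fst p + width (S n))%R, snd p)))) as [h2|h2].
  { eexists; intros [? [? [? ?]]]; unfold inside; simpl.
    repeat split; [..|exact h2]; simpl; lra. }
  destruct (Rle_dec (Cmod (cell n p))
    (4 * Cmod (cell (S n) (fst p, snd p + height (S n))))) as [h3|h3].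
  { eexists; intros [? [? [? ?]]]; unfold inside; simpl.
    repeat split; [..|exact h3]; simpl; lra. }
  exists ((fst p + width (S n))%R, snd p + height (S n)); intros Hin.
  pose proof (cell_split n p Hin) as E.
  destruct Hin as [? [? [? ?]]]; unfold inside; simpl; repeat split; try lra.
  assert (T : Cmod (cell n p) <= Cmod (cell (S n) p)
     + Cmod (cell (S n) ((fst p + width (S n))%R, snd p))
     + (Cmod (cell (S n) (fst p, snd p + height (S n)))
     + Cmod (cell (S n) ((fst p + width (S n))%R, snd p + height (S n))))).
  { rewrite E.
    eapply Rle_trans; [apply Cmod_triangle|].
    apply Rplus_le_compat; apply Cmod_triangle. }
  lra.
Qed.

Fixpoint corner (n : nat) : R * R :=
  match n with
  | O => (a, c)
  | S n => proj1_sig (bad_quarter n (corner n))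
  end.

Lemma corner_inside n :
  inside n (corner n) /\ Cmod (cell 0 (a, c)) <= 4 ^ n * Cmod (cell n (corner n)).
Proof.
  induction n as [|n [IH1 IH2]].
  - simpl corner; split; [|simpl pow; lra].
    unfold inside, width, height; simpl; repeat split; lra.
  - simpl corner; destruct (bad_quarter n (corner n)) as [q Hq]; simpl.
    destruct (Hq IH1) as [H1 [_ [_ H2]]]; split; [exact H1|].
    eapply Rle_trans; [exact IH2|].
    replace (4 * 4 ^ n * Cmod (cell (S n) q)) with (4 ^ n * (4 * Cmod (cell (S n) q))) by ring.
    apply Rmult_le_compat_l; [apply pow_le; lra|exact H2].
Qed.

Lemma corner_step n :
  fst (corner n) <= fst (corner (S n)) <= fst (corner n) + width (S n) /\
  snd (corner n) <= snd (corner (S n)) <= snd (corner n) + height (S n).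
Proof.
  simpl corner; destruct (bad_quarter n (corner n)) as [q Hq]; simpl.
  destruct (Hq (proj1 (corner_inside n))) as [_ [H1 [H2 _]]]; split; assumption.
Qed.

(** Nested cells, each a bad quarter of its predecessor, shrink to a point
    where the first-order expansion of [F] bounds the cell integral by an arbitrarily
    small multiple of the squared perimeter.  Both this and the guaranteed
    size of the cell integral shrink by 4 at each step, so the bound carries
    over to the whole rectangle. *)
Theorem goursat_rectangle : rect_int F a b c d = RtoC 0.
Proof.
  destruct (nested_dyadic_intervals (fun n => fst (corner n)) (b - a)) as [x Hx];
    [lra|intros n; apply corner_step|].
  destruct (nested_dyadic_intervals (fun n => snd (corner n)) (d - c)) as [y Hy];
    [lra|intros n; apply corner_step|].
  assert (E0 : cell 0 (a, c) = rect_int F a b c d).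
  { unfold cell, width, height; simpl; f_equal; field. }
  assert (Hxy : hol_at F (x, y)).
  { pose proof (Hx 0%nat) as H1; pose proof (Hy 0%nat) as H2; simpl in H1, H2.
    apply HF; lra. }
  destruct (hol_at_expansion F (x, y) Hxy) as [l Hl].
  set (s := (b - a) + (d - c)).
  assert (Hs : 0 <= s) by (unfold s; lra).
  apply Cmod_eq_0, Rle_antisym; [|apply Cmod_ge_0].
  apply Rle_plus_epsilon; intros eps Heps; rewrite Rplus_0_l.
  (* The final bound is e times 2 s^2; the 1 covers s = 0. *)
  set (e := eps / (2 * (s * s) + 1)).
  assert (He : 0 < e) by (apply Rdiv_lt_0_compat; nra).
  destruct (Hl e He) as [dl [Hdl Hloc]].
  assert (Hn : exists n, s / 2 ^ n < dl).
  { destruct (pow_lt_1_zero (1 / 2) ltac:(rewrite Rabs_right; lra) (dl / (s + 1)))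
      as [n Hn]; [apply Rdiv_lt_0_compat; lra|].
    exists n; specialize (Hn n (Nat.le_refl n)).
    rewrite Rabs_right in Hn by (apply Rle_ge, pow_le; lra).
    replace (s / 2 ^ n) with (s * (1 / 2) ^ n)
      by (unfold Rdiv; rewrite Rmult_1_l, pow_inv; reflexivity).
    assert (0 < (1 / 2) ^ n) by (apply pow_lt; lra).
    apply Rle_lt_trans with ((s + 1) * (1 / 2) ^ n); [nra|].
    apply Rmult_lt_reg_r with (/ (s + 1)); [apply Rinv_0_lt_compat; lra|].
    replace ((s + 1) * (1 / 2) ^ n * / (s + 1)) with ((1 / 2) ^ n) by (field; lra).
    exact Hn. }
  destruct Hn as [n Hn].
  destruct (corner_inside n) as [[I1 [I2 [I3 I4]]] I5].
  specialize (Hx n); specialize (Hy n); cbv beta in Hx, Hy.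
  pose proof (width_pos n); pose proof (height_pos n).
  assert (Es : width n + height n = s / 2 ^ n) by (unfold width, height, s; field; apply pow_nonzero; lra).
  assert (B : Cmod (cell n (corner n)) <= 2 * (e * (s / 2 ^ n)) * (s / 2 ^ n)).
  { unfold cell; rewrite <- Es at 2.
    replace (width n + height n) with
      ((fst (corner n) + width n - fst (corner n)) + (snd (corner n) + height n - snd (corner n))) by ring.
    assert (Hin : forall x' y', fst (corner n) <= x' <= fst (corner n) + width n ->
      snd (corner n) <= y' <= snd (corner n) + height n ->
      Cmod (F (x', y') - (F (x, y) - l * (x, y) + l * (x', y'))) <= e * (s / 2 ^ n)).
    { intros x' y' Hx' Hy'.
      assert (Hd : Cmod ((x', y') - (x, y))%C <= s / 2 ^ n).
      { eapply Rle_trans; [apply Cmod_le_sum|]; simpl.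
        rewrite <- Es; apply Rplus_le_compat; apply Rabs_le;
          unfold width, height in *; lra. }
      replace (F (x', y') - (F (x, y) - l * (x, y) + l * (x', y')))%C
        with (F (x', y') - F (x, y) - l * ((x', y') - (x, y)))%C by ring.
      eapply Rle_trans; [apply Hloc; lra|].
      apply Rmult_le_compat_l; lra. }
    apply (rect_int_le F _ _ _ _ _ (F (x, y) - l * (x, y))%C l); [lra|lra| | |].
    - split; intros; split; apply HF; lra.
    - intros x' Hx'; split; apply Hin; lra.
    - intros y' Hy'; split; apply Hin; lra. }
  rewrite E0 in I5; eapply Rle_trans; [exact I5|].
  assert (P : 0 < 2 ^ n) by (apply pow_lt; lra).
  apply Rle_trans with (4 ^ n * (2 * (e * (s / 2 ^ n)) * (s / 2 ^ n))).
  - apply Rmult_le_compat_l; [apply pow_le; lra|exact B].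
  - replace 4 with (2 * 2) by ring; rewrite Rpow_mult_distr.
    replace (2 ^ n * 2 ^ n * (2 * (e * (s / 2 ^ n)) * (s / 2 ^ n))) with (e * (2 * (s * s)))
      by (field; lra).
    apply Rle_trans with (e * (2 * (s * s) + 1)); [nra|].
    unfold e; right; field; nra.
Qed.
End GoursatBisection.

(** * The residue at a simple pole *)

Lemma rect_int_minus (F G : C -> C) (a b c d : R) :
  a <= b -> c <= d -> on_edges F a b c d -> on_edges G a b c d ->
  rect_int (fun w => F w - G w)%C a b c d = (rect_int F a b c d - rect_int G a b c d)%C.
Proof.
  intros Hab Hcd [F1 F2] [G1 G2]; unfold rect_int.
  assert (HF : forall y, y = c \/ y = d -> ex_CInt (fun x => F (x, y)) a b)
    by (intros y [->| ->]; apply ex_CInt_horizontal; try lra; apply F1).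
  assert (HG : forall y, y = c \/ y = d -> ex_CInt (fun x => G (x, y)) a b)
    by (intros y [->| ->]; apply ex_CInt_horizontal; try lra; apply G1).
  assert (VF : forall x, x = a \/ x = b -> ex_CInt (fun y => F (x, y)) c d)
    by (intros y [->| ->]; apply ex_CInt_vertical; try lra; apply F2).
  assert (VG : forall x, x = a \/ x = b -> ex_CInt (fun y => G (x, y)) c d)
    by (intros y [->| ->]; apply ex_CInt_vertical; try lra; apply G2).
  rewrite (CInt_ext (fun x => F (x, c) - G (x, c) - (F (x, d) - G (x, d)))%C
             (fun x => (F (x, c) - F (x, d)) - (G (x, c) - G (x, d)))%C a b Hab)
    by (intros; ring).
  rewrite (CInt_ext (fun y => F (b, y) - G (b, y) - (F (a, y) - G (a, y)))%C
             (fun y => (F (b, y) - F (a, y)) - (G (b, y) - G (a, y)))%C c d Hcd)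
    by (intros; ring).
  rewrite (CInt_minus (fun x => F (x, c) - F (x, d)) (fun x => G (x, c) - G (x, d)))%C
    by (apply ex_CInt_minus; auto).
  rewrite (CInt_minus (fun y => F (b, y) - F (a, y)) (fun y => G (b, y) - G (a, y)))%C
    by (apply ex_CInt_minus; auto).
  ring.
Qed.

Lemma CInt_Cmult_RtoC (c : C) (h : R -> R) (a b v : R) :
  is_RInt h a b v -> CInt (fun x => c * RtoC (h x))%C a b = (c * RtoC v)%C.
Proof.
  intros H; apply (is_RInt_unique (V := C_R_CompleteNormedModule)), is_CInt_Cmult.
  apply (is_RInt_fct_extend_pair (U := R_NormedModule) (V := R_NormedModule)).
  - exact H.
  - simpl; pose proof (is_RInt_const (V := R_NormedModule) a b 0) as H0.
    change (scal (b - a) 0) with ((b - a) * 0) in H0; rewrite Rmult_0_r in H0; exact H0.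
Qed.

Lemma is_RInt_arctan_density (p s : R) :
  0 < s -> is_RInt (fun x => s / ((x - p) ^ 2 + s ^ 2)) (p - s) (p + s) (PI / 2).
Proof.
  intros Hs.
  replace (PI / 2) with
    (minus (atan (((p + s) - p) / s)) (atan (((p - s) - p) / s))).
  - apply (is_RInt_derive (fun x => atan ((x - p) / s))
             (fun x => s / ((x - p) ^ 2 + s ^ 2))).
    + intros x _; auto_derive; [exact I|].
      pose proof (pow2_ge_0 (x - p)); unfold Rsqr; field; split; nra.
    + intros x _; apply (ex_derive_continuous (K := R_AbsRing) (V := R_NormedModule)).
      pose proof (pow2_ge_0 (x - p)); auto_derive; nra.
  - replace ((p + s - p) / s) with 1 by (field; lra).
    replace ((p - s - p) / s) with (- (1)) by (field; lra).
    rewrite atan_opp, atan_1; unfold minus, plus, opp; simpl; lra.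
Qed.

Lemma pair_eq (z : C) (x y : R) : fst z = x -> snd z = y -> z = (x, y).
Proof. destruct z; simpl; congruence. Qed.

Lemma Cminus_neq_0 (z w : C) : z <> w -> (z - w)%C <> RtoC 0.
Proof.
  intros H E; apply H.
  replace z with (z - w + w)%C by ring.
  rewrite E; ring.
Qed.

(** On a square centred at the pole, opposite sides combine into the arctangent
    density, and each of the two pairs contributes pi i r. *)
Lemma rect_int_simple_pole (r : C) (x0 y0 s : R) :
  0 < s ->
  rect_int (fun w => r / (w - (x0, y0)))%C (x0 - s) (x0 + s) (y0 - s) (y0 + s)
  = (RtoC (2 * PI) * Ci * r)%C.
Proof.
  intros Hs; unfold rect_int.
  assert (Hinv : forall u v : R, u <> 0 \/ v <> 0 ->
     (/ (u, v))%C = (u / (u ^ 2 + v ^ 2), - v / (u ^ 2 + v ^ 2))) by reflexivity.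
  rewrite (CInt_ext _ (fun x => (r * (2 * Ci)) * RtoC (s / ((x - x0) ^ 2 + s ^ 2)))%C)
    by (lra || (intros x _;
      replace ((x, y0 - s)%R - (x0, y0))%C with ((x - x0)%R, (- s)%R) by
        (symmetry; apply pair_eq; simpl; ring);
      replace ((x, y0 + s)%R - (x0, y0))%C with ((x - x0)%R, s) by
        (symmetry; apply pair_eq; simpl; ring);
      unfold Cdiv; rewrite !Hinv by (right; lra);
      unfold Cmult, Cminus, Cplus, Copp, Ci, RtoC; simpl;
      pose proof (pow2_ge_0 (x - x0)); pose proof (pow_lt s 2 Hs);
      f_equal; field; repeat split; nra)).
  rewrite (CInt_Cmult_RtoC _ _ _ _ _ (is_RInt_arctan_density x0 s Hs)).
  rewrite (CInt_ext _ (fun y => (r * 2) * RtoC (s / ((y - y0) ^ 2 + s ^ 2)))%C)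
    by (lra || (intros y _;
      replace ((x0 + s, y)%R - (x0, y0))%C with (s, (y - y0)%R) by
        (symmetry; apply pair_eq; simpl; ring);
      replace ((x0 - s, y)%R - (x0, y0))%C with ((- s)%R, (y - y0)%R) by
        (symmetry; apply pair_eq; simpl; ring);
      unfold Cdiv; rewrite !Hinv by (left; lra);
      unfold Cmult, Cminus, Cplus, Copp, Ci, RtoC; simpl;
      pose proof (pow2_ge_0 (y - y0)); pose proof (pow_lt s 2 Hs);
      f_equal; field; repeat split; nra)).
  rewrite (CInt_Cmult_RtoC _ _ _ _ _ (is_RInt_arctan_density y0 s Hs)).
  replace (2 * PI) with (2 * (2 * (PI / 2))) by field.
  rewrite !RtoC_mult; ring.
Qed.

(** By Goursat the rectangle may be replaced by a small square centred at
    the singularity.  There [F] is [r / (w - w0)] up to an error o(1 / s),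
    which integrates to o(1) over a perimeter of order s.  Asking only for the
    limit of [(w - w0) * F w] spares any extension of [F] across [w0]. *)
Theorem rect_int_residue (F : C -> C) (a b c d x0 y0 : R) (r : C) :
  a < x0 < b -> c < y0 < d ->
  (forall x y, a <= x <= b -> c <= y <= d -> (x, y) <> (x0, y0) -> hol_at F (x, y)) ->
  (forall eps, 0 < eps -> exists dl, 0 < dl /\ forall w : C,
     w <> (x0, y0) -> Cmod (w - (x0, y0)) < dl ->
     Cmod ((w - (x0, y0)) * F w - r) <= eps) ->
  rect_int F a b c d = (RtoC (2 * PI) * Ci * r)%C.
Proof.
  intros Hx0 Hy0 HF Hr.
  assert (Hsmall : forall s, 0 < s -> s < x0 - a -> s < b - x0 -> s < y0 - c -> s < d - y0 ->
    rect_int F a b c d = rect_int F (x0 - s) (x0 + s) (y0 - s) (y0 + s)).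
  { intros s H0 H1 H2 H3 H4.
    assert (Hne : forall x y, x <> x0 \/ y <> y0 -> (x, y) <> (x0, y0))
      by (intros x y [H|H] E; injection E; intros; contradiction).
    rewrite (rect_int_split_x F a (x0 - s) b); try lra.
    2, 3: split; intros; split; apply HF; try lra; apply Hne; lra.
    rewrite (rect_int_split_x F (x0 - s) (x0 + s) b); try lra.
    2, 3: split; intros; split; apply HF; try lra; apply Hne; lra.
    rewrite (goursat_rectangle F a (x0 - s) c d); try lra.
    2: intros; apply HF; try lra; apply Hne; lra.
    rewrite (goursat_rectangle F (x0 + s) b c d); try lra.
    2: intros; apply HF; try lra; apply Hne; lra.
    rewrite (rect_int_split_y F (x0 - s) (x0 + s) c (y0 - s) d); try lra.
    2, 3: split; intros; split; apply HF; try lra; apply Hne; lra.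
    rewrite (rect_int_split_y F (x0 - s) (x0 + s) (y0 - s) (y0 + s) d); try lra.
    2, 3: split; intros; split; apply HF; try lra; apply Hne; lra.
    rewrite (goursat_rectangle F (x0 - s) (x0 + s) c (y0 - s)); try lra.
    2: intros; apply HF; try lra; apply Hne; lra.
    rewrite (goursat_rectangle F (x0 - s) (x0 + s) (y0 + s) d); try lra.
    2: intros; apply HF; try lra; apply Hne; lra.
    ring. }
  assert (Heq : forall z : C, Cmod z <= 0 -> z = RtoC 0)
    by (intros z Hz; apply Cmod_eq_0, Rle_antisym; [exact Hz|apply Cmod_ge_0]).
  replace (rect_int F a b c d)
    with (rect_int F a b c d - RtoC (2 * PI) * Ci * r + RtoC (2 * PI) * Ci * r)%C by ring.
  rewrite (Heq (rect_int F a b c d - RtoC (2 * PI) * Ci * r)%C); [ring|].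
  apply Rle_plus_epsilon; intros eps Heps; rewrite Rplus_0_l.
  destruct (Hr (eps / 8) ltac:(lra)) as [dl [Hdl Hloc]].
  (* Points on the boundary of the square are at distance at most 2 s < dl. *)
  set (s := Rmin (dl / 3) (Rmin (Rmin (x0 - a) (b - x0)) (Rmin (y0 - c) (d - y0)) / 2)).
  assert (Hs : 0 < s /\ s <= dl / 3 /\ s < x0 - a /\ s < b - x0 /\ s < y0 - c /\ s < d - y0).
  { unfold s, Rmin; repeat destruct (Rle_dec _ _); lra. }
  destruct Hs as [Hs0 [Hs1 [Hs2 [Hs3 [Hs4 Hs5]]]]].
  rewrite (Hsmall s) by assumption.
  rewrite <- (rect_int_simple_pole r x0 y0 s Hs0).
  set (P := fun w : C => (r / (w - (x0, y0)))%C).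
  assert (Hedge : forall x y, x0 - s <= x <= x0 + s -> y0 - s <= y <= y0 + s ->
    (x = x0 - s \/ x = x0 + s \/ y = y0 - s \/ y = y0 + s) ->
    s <= Cmod ((x, y) - (x0, y0)) /\ Cmod ((x, y) - (x0, y0)) < dl).
  { intros x y Hx Hy Hxy; split.
    - pose proof (Rabs_fst_le ((x, y) - (x0, y0))%C) as H1.
      pose proof (Rabs_snd_le ((x, y) - (x0, y0))%C) as H2.
      simpl in H1, H2; apply Rabs_le_between in H1; apply Rabs_le_between in H2; lra.
    - eapply Rle_lt_trans; [apply Cmod_le_sum|]; simpl.
      assert (Rabs (x + - x0) <= s) by (apply Rabs_le; lra).
      assert (Rabs (y + - y0) <= s) by (apply Rabs_le; lra).
      lra. }
  assert (Hne : forall x y, s <= Cmod ((x, y) - (x0, y0))%C -> (x, y) <> (x0, y0)).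
  { intros x y H E; rewrite E in H.
    replace ((x0, y0) - (x0, y0))%C with (RtoC 0) in H by ring.
    rewrite Cmod_0 in H; lra. }
  assert (HolP : forall x y, (x, y) <> (x0, y0) -> hol_at P (x, y)).
  { intros x y H; apply hol_at_div; [apply hol_at_const| |].
    - apply hol_at_minus; [apply hol_at_id|apply hol_at_const].
    - apply Cminus_neq_0, H. }
  assert (EF : on_edges F (x0 - s) (x0 + s) (y0 - s) (y0 + s)).
  { split; intros; split; apply HF; try lra; apply Hne, Hedge; lra. }
  assert (EP : on_edges P (x0 - s) (x0 + s) (y0 - s) (y0 + s)).
  { split; intros; split; apply HolP; apply Hne, Hedge; lra. }
  rewrite <- rect_int_minus by (lra || assumption).
  assert (Hb : forall x y, x0 - s <= x <= x0 + s -> y0 - s <= y <= y0 + s ->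
    (x = x0 - s \/ x = x0 + s \/ y = y0 - s \/ y = y0 + s) ->
    Cmod (F (x, y) - P (x, y) - (0 + 0 * (x, y)))%C <= eps / 8 / s).
  { intros x y Hx Hy Hxy.
    destruct (Hedge x y Hx Hy Hxy) as [Hm1 Hm2].
    assert (Hn := Hne x y Hm1).
    assert (Hn0 : ((x, y) - (x0, y0))%C <> RtoC 0) by (apply Cmod_gt_0; lra).
    specialize (Hloc (x, y) Hn Hm2).
    replace (F (x, y) - P (x, y) - (0 + 0 * (x, y)))%C
      with ((((x, y) - (x0, y0)) * F (x, y) - r) / ((x, y) - (x0, y0)))%C
      by (unfold P; field; exact Hn0).
    rewrite Cmod_div by exact Hn0.
    apply Rmult_le_compat; [apply Cmod_ge_0|apply Rlt_le, Rinv_0_lt_compat; lra|exact Hloc|].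
    apply Rinv_le_contravar; lra. }
  eapply Rle_trans.
  - apply (rect_int_le _ _ _ _ _ (eps / 8 / s) 0 0); [lra|lra| | |].
    + destruct EF as [A1 A2], EP as [B1 B2].
      split; intros t Ht; split; apply hol_at_minus;
        (apply A1 + apply A2 + apply B1 + apply B2); exact Ht.
    + intros x Hx; split; apply Hb; lra.
    + intros y Hy; split; apply Hb; lra.
  - right; field; lra.
Qed.

(** * Cauchy's formula in the slit disk *)

Lemma sector_cexp (w : C) :
  fst w < 0 -> - PI < snd w < PI -> sector PI (cexp w).
Proof.
  intros Hx Hy; split.
  - rewrite Cmod_cexp, <- exp_0; apply exp_increasing, Hx.
  - exists (snd w); split; [|exact Hy].
    split; [apply cexp_neq_0|split; [lra|]].
    rewrite Cmod_cexp; reflexivity.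
Qed.

Lemma cexp_minus (v w : C) : cexp (v - w) = (cexp v / cexp w)%C.
Proof.
  replace (cexp v) with (cexp (v - w) * cexp w)%C
    by (rewrite <- cexp_plus; f_equal; ring).
  field; apply cexp_neq_0.
Qed.

Lemma cexp_eq_1 (w : C) : - (2 * PI) < snd w < 2 * PI -> cexp w = RtoC 1 -> w = RtoC 0.
Proof.
  intros Hy E; destruct w as [x y]; simpl in Hy.
  assert (Hx : x = 0).
  { apply exp_inv; rewrite exp_0.
    change x with (fst ((x, y) : C)); rewrite <- Cmod_cexp, E; apply Cmod_1. }
  subst x; injection E; unfold cexp; simpl; rewrite exp_0, !Rmult_1_l; intros _ Hc.
  assert (Hs : sin (y / 2) = 0).
  { replace y with (2 * (y / 2)) in Hc by field.
    rewrite cos_2a_sin in Hc; nra. }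
  unfold RtoC; f_equal.
  destruct (Rtotal_order y 0) as [h|[h|h]]; [|exact h|].
  - pose proof (sin_gt_0 (- (y / 2)) ltac:(lra) ltac:(lra)) as H; rewrite sin_neg in H; lra.
  - pose proof (sin_gt_0 (y / 2) ltac:(lra) ltac:(lra)); lra.
Qed.

Lemma cexp_inj (v w : C) :
  - PI < snd v < PI -> - PI < snd w < PI -> cexp v = cexp w -> v = w.
Proof.
  intros Hv Hw E.
  assert (E0 : (v - w)%C = RtoC 0).
  { apply cexp_eq_1; [simpl; lra|].
    rewrite cexp_minus, E; field; apply cexp_neq_0. }
  replace v with (v - w + w)%C by ring; rewrite E0; ring.
Qed.

(** The integrand f(t) dt / (t - z) after the substitution t = exp w. *)
Definition cauchy_kernel (f : C -> C) (z w : C) : C :=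
  (f (cexp w) * (cexp w / (cexp w - z)))%C.

(** The residue of exp(w) / (exp(w) - z) at log z is 1. *)
Lemma cexp_residue_factor (h : C) :
  h <> RtoC 0 -> Cmod h <= 1 / 16 ->
  Cmod (h * (cexp h / (cexp h - 1)) - 1) <= 26 * Cmod h.
Proof.
  intros H0 Hh.
  pose proof (cexp_quadratic h ltac:(lra)) as Hq.
  set (u := (cexp h - 1 - h)%C) in *.
  assert (Hm : 0 < Cmod h) by (apply Cmod_gt_0; exact H0).
  set (m := Cmod h) in *.
  assert (Hd : m / 2 <= Cmod (cexp h - 1)).
  { pose proof (Cmod_lower (cexp h - 1) h (8 * m ^ 2) Hq); unfold m in *; nra. }
  assert (Hd0 : (cexp h - 1)%C <> RtoC 0) by (apply Cmod_gt_0; lra).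
  replace (h * (cexp h / (cexp h - 1)) - 1)%C
    with ((h * h + h * u - u) / (cexp h - 1))%C
    by (unfold u; field; exact Hd0).
  rewrite Cmod_div by exact Hd0.
  assert (Hnum : Cmod (h * h + h * u - u)%C <= 13 * m ^ 2).
  { eapply Rle_trans; [apply Cmod_triangle|]; rewrite Cmod_opp.
    pose proof (Cmod_triangle (h * h) (h * u)) as Ht; rewrite !Cmod_mult in Ht.
    fold m in Ht; pose proof (Cmod_ge_0 u).
    assert (m * Cmod u <= 1 / 16 * (8 * m ^ 2)) by (apply Rmult_le_compat; lra).
    nra. }
  apply Rle_trans with (13 * m ^ 2 / (m / 2)).
  - apply Rmult_le_compat; [apply Cmod_ge_0|apply Rlt_le, Rinv_0_lt_compat; lra|exact Hnum|].
    apply Rinv_le_contravar; lra.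
  - right; field; lra.
Qed.

Theorem cauchy_formula_slit_disk (f : C -> C) (a b c d : R) (w0 : C) :
  holomorphic_on (sector PI) f ->
  a < fst w0 < b -> c < snd w0 < d -> b < 0 -> - PI < c -> d < PI ->
  rect_int (cauchy_kernel f (cexp w0)) a b c d = (RtoC (2 * PI) * Ci * f (cexp w0))%C.
Proof.
  intros Hf Hx Hy Hb Hc Hd; destruct w0 as [x0 y0]; simpl in Hx, Hy.
  set (w0 := (x0, y0) : C); set (z := cexp w0).
  assert (Hz : z <> RtoC 0) by apply cexp_neq_0.
  assert (Hfe : forall x y, x <= b -> c <= y <= d -> hol_at (fun w => f (cexp w)) (x, y)).
  { intros x y Hx' Hy'; apply hol_at_comp; [|apply hol_at_cexp].
    apply (holomorphic_on_hol_at _ _ _ Hf), sector_cexp; simpl; lra. }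
  apply (rect_int_residue _ _ _ _ _ x0 y0 _ Hx Hy).
  - intros x y Hx' Hy' Hne.
    apply hol_at_mult; [apply Hfe; lra|].
    apply hol_at_div; [apply hol_at_cexp| |].
    + apply hol_at_minus; [apply hol_at_cexp|apply hol_at_const].
    + apply Cminus_neq_0; intros E; apply Hne.
      apply cexp_inj; [simpl; lra|simpl; lra|exact E].
  - intros eps Heps; fold w0.
    set (M := Cmod (f z) + 1).
    assert (HM : 0 < M) by (pose proof (Cmod_ge_0 (f z)); unfold M; lra).
    assert (He : 0 < Rmin 1 (eps / 2)) by (apply Rmin_pos; lra).
    assert (Hnear : locally (T := AbsRing_UniformSpace C_AbsRing) w0
              (fun w : C => Cmod (f (cexp w) - f z) < Rmin 1 (eps / 2))).
    { apply (hol_at_ccont _ _ (Hfe x0 y0 ltac:(lra) ltac:(lra))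
        (fun v : C => Cmod (v - f z) < Rmin 1 (eps / 2))).
      exists (mkposreal _ He); intros v Hv; exact Hv. }
    destruct Hnear as [dl Hdl].
    set (dl' := Rmin dl (Rmin (1 / 16) (eps / (2 * (26 * M))))).
    assert (Hdl' : 0 < dl').
    { repeat apply Rmin_pos; try lra; [apply cond_pos|apply Rdiv_lt_0_compat; lra]. }
    exists dl'; split; [exact Hdl'|].
    intros w Hw Hwd.
    assert (D1 : Cmod (w - w0) < dl) by (eapply Rlt_le_trans; [exact Hwd|apply Rmin_l]).
    assert (D2 : Cmod (w - w0) < 1 / 16).
    { eapply Rlt_le_trans; [exact Hwd|].
      eapply Rle_trans; [apply Rmin_r|apply Rmin_l]. }
    assert (D3 : Cmod (w - w0) < eps / (2 * (26 * M))).
    { eapply Rlt_le_trans; [exact Hwd|].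
      eapply Rle_trans; [apply Rmin_r|apply Rmin_r]. }
    specialize (Hdl w D1); cbv beta in Hdl.
    assert (F1 : Cmod (f (cexp w) - f z) < 1)
      by (eapply Rlt_le_trans; [exact Hdl|apply Rmin_l]).
    assert (F2 : Cmod (f (cexp w) - f z) < eps / 2)
      by (eapply Rlt_le_trans; [exact Hdl|apply Rmin_r]).
    assert (F3 : Cmod (f (cexp w)) <= M).
    { replace (f (cexp w)) with (f z + (f (cexp w) - f z))%C by ring.
      eapply Rle_trans; [apply Cmod_triangle|]; unfold M; lra. }
    assert (Hh : (w - w0)%C <> RtoC 0) by (apply Cminus_neq_0; exact Hw).
    pose proof (cexp_residue_factor (w - w0) Hh ltac:(lra)) as Hk.
    assert (Hne1 : (cexp (w - w0) - 1)%C <> RtoC 0).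
    { intros E.
      pose proof (cexp_quadratic (w - w0) ltac:(lra)) as Hq; rewrite E in Hq.
      replace (0 - (w - w0))%C with (- (w - w0))%C in Hq by ring.
      rewrite Cmod_opp in Hq; apply Cmod_gt_0 in Hh; nra. }
    replace (cexp (w - w0) / (cexp (w - w0) - 1))%C with (cexp w / (cexp w - z))%C in Hk.
    2: { rewrite cexp_minus in *; fold z in Hne1 |- *.
         assert ((cexp w - z)%C <> RtoC 0).
         { intros E; apply Hne1.
           replace (cexp w / z - 1)%C with ((cexp w - z) / z)%C by (field; exact Hz).
           rewrite E; field; exact Hz. }
         field; split; assumption. }
    unfold cauchy_kernel.
    replace ((w - w0) * (f (cexp w) * (cexp w / (cexp w - z))) - f z)%C
      with (f (cexp w) * ((w - w0) * (cexp w / (cexp w - z)) - 1) + (f (cexp w) - f z))%C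
      by ring.
    eapply Rle_trans; [apply Cmod_triangle|].
    rewrite Cmod_mult.
    assert (Cmod (f (cexp w)) * Cmod ((w - w0) * (cexp w / (cexp w - z)) - 1)%C <= eps / 2).
    { apply Rle_trans with (M * (26 * (eps / (2 * (26 * M))))).
      - apply Rmult_le_compat; try apply Cmod_ge_0; lra.
      - right; field; lra. }
    lra.
Qed.

(** * Finite products, polynomials and poles of rational functions *)

Fixpoint csum (g : nat -> C) (k : nat) : C :=
  match k with O => RtoC 0 | S k => (csum g k + g k)%C end.

Fixpoint cprod (g : nat -> C) (k : nat) : C :=
  match k with O => RtoC 1 | S k => (cprod g k * g k)%C end.

Lemma cprod_ext (g h : nat -> C) (k : nat) :
  (forall i, (i < k)%nat -> g i = h i) -> cprod g k = cprod h k.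
Proof.
  induction k as [|k IH]; intros H; simpl; [reflexivity|].
  rewrite IH, H; auto.
Qed.

Lemma cprod_neq_0 (g : nat -> C) (k : nat) :
  (forall i, (i < k)%nat -> g i <> RtoC 0) -> cprod g k <> RtoC 0.
Proof.
  induction k as [|k IH]; intros H; simpl.
  - apply C1_nz.
  - apply Cmult_neq_0; auto.
Qed.

Lemma cprod_factor_neq_0 (g : nat -> C) (k i : nat) :
  cprod g k <> RtoC 0 -> (i < k)%nat -> g i <> RtoC 0.
Proof.
  induction k as [|k IH]; intros H Hi E; [lia|]; simpl in H; apply H.
  destruct (Nat.eq_dec i k) as [->|Hne]; [rewrite E; ring|].
  destruct (Ceq_dec (cprod g k) 0) as [E0|E0]; [rewrite E0; ring|].
  exfalso; apply (IH E0); [lia|exact E].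
Qed.

Lemma cprod_split (g : nat -> C) (k j : nat) :
  (j < k)%nat ->
  cprod g k = (g j * cprod (fun i => if Nat.eqb i j then RtoC 1 else g i) k)%C.
Proof.
  induction k as [|k IH]; intros Hj; [lia|]; simpl.
  destruct (Nat.eqb_spec k j) as [->|Hne].
  - rewrite (cprod_ext (fun i => if Nat.eqb i j then RtoC 1 else g i) g j); [ring|].
    intros i Hi; destruct (Nat.eqb_spec i j); [lia|reflexivity].
  - rewrite IH by lia; ring.
Qed.

Lemma hol_at_cprod (g : nat -> C -> C) (k : nat) (p : C) :
  (forall i, (i < k)%nat -> hol_at (g i) p) -> hol_at (fun z => cprod (fun i => g i z) k) p.
Proof.
  induction k as [|k IH]; intros H; simpl; [apply hol_at_const|].
  apply hol_at_mult; auto.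
Qed.

Definition is_poly (m : nat) (P : C -> C) : Prop :=
  exists a : nat -> C, forall z, Defs.poly a m z = P z.

Lemma poly_S (a : nat -> C) (m : nat) (z : C) :
  Defs.poly a (S m) z = (Defs.poly a m z + a (S m) * z ^ S m)%C.
Proof. unfold Defs.poly; rewrite sum_Sn; reflexivity. Qed.

Lemma poly_0 (a : nat -> C) (z : C) : Defs.poly a 0 z = a O.
Proof. unfold Defs.poly; rewrite sum_O; simpl; ring. Qed.

Lemma is_poly_ext (m : nat) (P Q : C -> C) :
  (forall z, P z = Q z) -> is_poly m P -> is_poly m Q.
Proof. intros H [a Ha]; exists a; intros z; rewrite Ha; apply H. Qed.

Lemma is_poly_const (c : C) : is_poly 0 (fun _ => c).
Proof. exists (fun _ => c); intros z; apply poly_0. Qed.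

Lemma is_poly_le (m n : nat) (P : C -> C) :
  (m <= n)%nat -> is_poly m P -> is_poly n P.
Proof.
  induction 1 as [|n _ IH]; [trivial|]; intros HP.
  destruct (IH HP) as [a Ha].
  exists (fun k => if Nat.eqb k (S n) then RtoC 0 else a k); intros z.
  rewrite poly_S, Nat.eqb_refl, <- Ha.
  unfold Defs.poly; rewrite (sum_n_ext_loc _ (fun k => a k * z ^ k)%C); [ring|].
  intros k Hk; destruct (Nat.eqb_spec k (S n)); [lia|reflexivity].
Qed.

Lemma is_poly_plus (m : nat) (P Q : C -> C) :
  is_poly m P -> is_poly m Q -> is_poly m (fun z => P z + Q z)%C.
Proof.
  intros [a Ha] [b Hb]; exists (fun k => a k + b k)%C; intros z.
  rewrite <- Ha, <- Hb; clear; induction m as [|m IH].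
  - rewrite !poly_0; reflexivity.
  - rewrite !poly_S, IH; ring.
Qed.

Lemma is_poly_scal (m : nat) (c : C) (P : C -> C) :
  is_poly m P -> is_poly m (fun z => c * P z)%C.
Proof.
  intros [a Ha]; exists (fun k => c * a k)%C; intros z.
  rewrite <- Ha; clear; induction m as [|m IH].
  - rewrite !poly_0; reflexivity.
  - rewrite !poly_S, IH; ring.
Qed.

Lemma is_poly_shift (m : nat) (P : C -> C) :
  is_poly m P -> is_poly (S m) (fun z => z * P z)%C.
Proof.
  intros [a Ha]; exists (fun k => match k with O => RtoC 0 | S k => a k end); intros z.
  rewrite <- Ha; clear; induction m as [|m IH].
  - rewrite poly_S, !poly_0; simpl; ring.
  - rewrite poly_S, IH, (poly_S a); simpl; ring.
Qed.

Lemma is_poly_linear (m : nat) (P : C -> C) (w : C) :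
  is_poly m P -> is_poly (S m) (fun z => P z * (z - w))%C.
Proof.
  intros HP.
  apply (is_poly_ext _ (fun z => z * P z + (- w) * P z)%C); [intros; ring|].
  apply is_poly_plus; [apply is_poly_shift, HP|].
  apply is_poly_scal, (is_poly_le m); auto.
Qed.

Lemma is_poly_cprod (m : nat) (P : C -> C) (p : nat -> C) (k : nat) :
  is_poly m P -> is_poly (k + m) (fun z => P z * cprod (fun i => z - p i) k)%C.
Proof.
  intros HP; induction k as [|k IH]; simpl.
  - apply (is_poly_ext _ P); [intros; ring|exact HP].
  - apply (is_poly_ext _ (fun z => (P z * cprod (fun i => z - p i) k) * (z - p k))%C);
      [intros; ring|].
    apply is_poly_linear, IH.
Qed.

(** Of the quotient, only differentiability is recorded: this is all that
    removing a singularity takes. *)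
Lemma is_poly_divided_difference (m : nat) (P : C -> C) (w : C) :
  is_poly m P ->
  exists Q, (forall z, hol_at Q z) /\ forall z, P z = (P w + (z - w) * Q z)%C.
Proof.
  intros [a Ha].
  assert (Hpow : forall n, exists q, (forall z, hol_at q z) /\
            forall z, (z ^ n = w ^ n + (z - w) * q z)%C).
  { induction n as [|n [q [Hq E]]].
    - exists (fun _ => RtoC 0); split; [intros; apply hol_at_const|intros; simpl; ring].
    - exists (fun z => w ^ n + z * q z)%C; split.
      + intros z; apply hol_at_plus; [apply hol_at_const|].
        apply hol_at_mult; [apply hol_at_id|apply Hq].
      + intros z; simpl; rewrite E; ring. }
  assert (H : exists Q, (forall z, hol_at Q z) /\
            forall z, Defs.poly a m z = (Defs.poly a m w + (z - w) * Q z)%C).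
  { clear Ha; induction m as [|m [Q [HQ E]]].
    - exists (fun _ => RtoC 0); split; [intros; apply hol_at_const|].
      intros; rewrite !poly_0; ring.
    - destruct (Hpow (S m)) as [q [Hq Eq]].
      exists (fun z => Q z + a (S m) * q z)%C; split.
      + intros z; apply hol_at_plus; [apply HQ|].
        apply hol_at_mult; [apply hol_at_const|apply Hq].
      + intros z; rewrite !poly_S, E, Eq; ring. }
  destruct H as [Q [HQ E]]; exists Q; split; [exact HQ|].
  intros z; rewrite <- !Ha; apply E.
Qed.

Lemma is_poly_hol (m : nat) (P : C -> C) (z : C) : is_poly m P -> hol_at P z.
Proof.
  intros HP; destruct (is_poly_divided_difference m P z HP) as [Q [HQ E]].
  destruct (hol_at_plus (fun _ => P z) (fun w => (w - z) * Q w)%C z) as [l Hl].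
  - apply hol_at_const.
  - apply hol_at_mult; [|apply HQ].
    apply hol_at_minus; [apply hol_at_id|apply hol_at_const].
  - exists l; revert Hl; apply (is_derive_ext (K := C_AbsRing)).
    intros t; symmetry; apply E.
Qed.

Lemma hol_at_near (g : C -> C) (w : C) (eps : R) :
  hol_at g w -> 0 < eps -> locally w (fun z : C => Cmod (g z - g w) < eps).
Proof.
  intros Hg He; apply locally_C.
  apply (hol_at_ccont g w Hg (fun v : C => Cmod (v - g w) < eps)).
  exists (mkposreal eps He); intros v Hv; exact Hv.
Qed.

Lemma locally'_inhabited (w : C) (P : C -> Prop) : locally' w P -> exists z, P z.
Proof.
  intros H; apply locally_C in H; destruct H as [eps H].
  exists (w + RtoC (eps / 2))%C; pose proof (cond_pos eps).
  apply H.
  - change (Cmod (w + RtoC (eps / 2) - w) < eps).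
    replace (w + RtoC (eps / 2) - w)%C with (RtoC (eps / 2)) by ring.
    rewrite Cmod_R, Rabs_right; lra.
  - intros E.
    assert (E0 : RtoC (eps / 2) = RtoC 0).
    { replace (RtoC (eps / 2)) with (w + RtoC (eps / 2) - w)%C by ring.
      rewrite E; ring. }
    injection E0; lra.
Qed.

Lemma locally_locally' (w : C) (P : C -> Prop) : locally w P -> locally' w P.
Proof. unfold locally', within; apply filter_imp; auto. Qed.

Lemma not_pole_of_extension (r g : C -> C) (w : C) :
  hol_at g w -> locally' w (fun z => r z = g z) -> ~ is_pole r w.
Proof.
  intros Hg Hrg Hp.
  assert (Hbig : locally' w (fun z => Cmod (g w) + 1 < Cmod (r z))).
  { apply (Hp (fun x => Cmod (g w) + 1 < x)); exists (Cmod (g w) + 1); auto. }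
  pose proof (hol_at_near g w 1 Hg Rlt_0_1) as Hnear.
  assert (Hall : locally' w (fun z => r z = g z /\ Cmod (g w) + 1 < Cmod (r z)
                               /\ Cmod (g z - g w) < 1)).
  { apply filter_and; [exact Hrg|]; apply filter_and; [exact Hbig|].
    apply locally_locally', Hnear. }
  destruct (locally'_inhabited w _ Hall) as [z [E [H1 H2]]].
  rewrite E in H1.
  pose proof (Cmod_triangle (g w) (g z - g w)) as H3.
  replace (g w + (g z - g w))%C with (g z) in H3 by ring; lra.
Qed.

Lemma simple_pole_of_residue (r g : C -> C) (w : C) :
  hol_at g w -> g w <> RtoC 0 ->
  locally' w (fun z => ((z - w) * r z)%C = g z) -> is_simple_pole r w.
Proof.
  intros Hg H0 Hrg; exists (g w); split; [exact H0|].
  intros P HP; apply locally_C in HP.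
  pose proof (hol_at_ccont g w Hg P HP) as H1; apply locally_C in H1.
  unfold filtermap in *.
  assert (H2 : locally' w (fun z => P (g z)))
    by (apply locally_locally', H1).
  generalize (filter_and _ _ Hrg H2); apply filter_imp.
  intros z [E Hz]; rewrite E; exact Hz.
Qed.

(** At a zero [p j] of the denominator the residue is N(p j) over a nonzero
    number.  If it vanishes the numerator can be divided by z - p j, and
    the singularity is removable. *)
Theorem rational_simple_poles (m k : nat) (N r : C -> C) (p : nat -> C) :
  is_poly m N ->
  (forall i j, (i < k)%nat -> (j < k)%nat -> p i = p j -> i = j) ->
  (forall z, cprod (fun i => z - p i)%C k <> RtoC 0 ->
     r z = (N z / cprod (fun i => z - p i) k)%C) ->
  forall w, is_pole r w -> (exists j, (j < k)%nat /\ w = p j) /\ is_simple_pole r w.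
Proof.
  intros HN Hinj Hr w Hw.
  assert (Hlin : forall (q : nat -> C) z, hol_at (fun z => cprod (fun i => z - q i) k)%C z).
  { intros q z; apply hol_at_cprod; intros i _.
    apply hol_at_minus; [apply hol_at_id|apply hol_at_const]. }
  assert (Hnz : forall g : C -> C, hol_at g w -> g w <> RtoC 0 ->
            locally' w (fun z => g z <> RtoC 0)).
  { intros g Hg H0; apply Cmod_gt_0 in H0.
    generalize (locally_locally' _ _ (hol_at_near g w _ Hg H0)); apply filter_imp.
    intros z Hz E; rewrite E in Hz.
    replace (0 - g w)%C with (- g w)%C in Hz by ring; rewrite Cmod_opp in Hz; lra. }
  destruct (Ceq_dec (cprod (fun i => w - p i)%C k) 0) as [E0|E0].
  2: { exfalso; revert Hw.
       apply (not_pole_of_extension r (fun z => N z / cprod (fun i => z - p i) k)%C).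
       - apply hol_at_div; [apply (is_poly_hol m), HN|apply Hlin|exact E0].
       - generalize (Hnz _ (Hlin p w) E0); apply filter_imp; exact Hr. }
  assert (Hj : exists j, (j < k)%nat /\ w = p j).
  { destruct (Classical_Prop.classic (exists j, (j < k)%nat /\ w = p j)) as [H|H]; [exact H|].
    exfalso; revert E0; apply cprod_neq_0; intros i Hi; apply Cminus_neq_0.
    intros E; apply H; exists i; auto. }
  split; [exact Hj|]; destruct Hj as [j [Hj Ew]].
  set (B := fun z => cprod (fun i => if Nat.eqb i j then RtoC 1 else (z - p i)%C) k).
  assert (HB : hol_at B w).
  { apply (hol_at_cprod (fun i z => if Nat.eqb i j then RtoC 1 else (z - p i)%C)).
    intros i _; destruct (Nat.eqb i j); [apply hol_at_const|].
    apply hol_at_minus; [apply hol_at_id|apply hol_at_const]. }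
  assert (HB0 : B w <> RtoC 0).
  { apply cprod_neq_0; intros i Hi; destruct (Nat.eqb_spec i j); [apply C1_nz|].
    apply Cminus_neq_0; rewrite Ew; intros E; apply n, Hinj; auto. }
  assert (Hfac : forall z, cprod (fun i => z - p i)%C k = ((z - w) * B z)%C)
    by (intros z; rewrite (cprod_split _ k j Hj), Ew; reflexivity).
  assert (Hpunct : locally' w (fun z => B z <> RtoC 0 /\ (z - w)%C <> RtoC 0)).
  { apply filter_and; [exact (Hnz B HB HB0)|].
    unfold locally', within; apply filter_forall; intros z Hz; apply Cminus_neq_0, Hz. }
  destruct (is_poly_divided_difference m N w HN) as [Q [HQ EQ]].
  destruct (Ceq_dec (N w) 0) as [EN|EN].
  - exfalso; revert Hw; apply (not_pole_of_extension r (fun z => Q z / B z)%C).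
    + apply hol_at_div; [apply HQ|exact HB|exact HB0].
    + generalize Hpunct; apply filter_imp; intros z [H1 H2].
      rewrite Hr, Hfac, EQ, EN by (rewrite Hfac; apply Cmult_neq_0; assumption).
      field; split; assumption.
  - apply (simple_pole_of_residue r (fun z => N z / B z)%C).
    + apply hol_at_div; [apply (is_poly_hol m), HN|exact HB|exact HB0].
    + unfold Cdiv; apply Cmult_neq_0; [exact EN|].
      intros E; apply C1_nz; rewrite <- (Cinv_r (B w) HB0), E; ring.
    + generalize Hpunct; apply filter_imp; intros z [H1 H2].
      rewrite Hr, Hfac by (rewrite Hfac; apply Cmult_neq_0; assumption).
      field; split; assumption.
Qed.

(** * The separated kernel *)

(** The function Phi: a Blaschke product of the right half-plane. *)
Definition blaschke (al : nat -> R) (k : nat) (z : C) : C :=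
  cprod (fun j => (z - al j) / (z + al j))%C k.

(** Up to constants, these are the Takenaka-Malmquist rational functions attached to
    the poles - alpha_j. *)
Definition malmquist (al : nat -> R) (j : nat) (z : C) : C :=
  (blaschke al j z / (z + al j))%C.

(** The coefficient of [malmquist al j] in the expansion of the kernel below, as a
    function of the contour point. *)
Definition malmquist_dual (al : nat -> R) (j : nat) (t : C) : C :=
  (2 * al j / ((t - al j) * blaschke al j t))%C.

Lemma blaschke_neq_0 (al : nat -> R) (k : nat) (t : C) :
  (forall j, (j < k)%nat -> (t - al j)%C <> RtoC 0 /\ (t + al j)%C <> RtoC 0) ->
  blaschke al k t <> RtoC 0.
Proof.
  intros H; apply cprod_neq_0; intros j Hj; destruct (H j Hj) as [H1 H2].
  intros E; apply H1.
  replace (t - al j)%C with ((t - al j) / (t + al j) * (t + al j))%C by (field; exact H2).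
  rewrite E; ring.
Qed.

(** Each factor contributes
    1 - phi_j(z) / phi_j(t) = 2 alpha_j (t - z) / ((z + alpha_j) (t - alpha_j)),
    and the sum telescopes. *)
Lemma malmquist_expansion (al : nat -> R) (k : nat) (z t : C) :
  (forall j, (j < k)%nat -> (z + al j)%C <> RtoC 0 /\
      (t - al j)%C <> RtoC 0 /\ (t + al j)%C <> RtoC 0) ->
  (t - z)%C <> RtoC 0 ->
  csum (fun j => malmquist_dual al j t * malmquist al j z)%C k
  = ((1 - blaschke al k z / blaschke al k t) / (t - z))%C.
Proof.
  intros H Htz; induction k as [|k IH]; simpl.
  - unfold blaschke; simpl; field; exact Htz.
  - rewrite IH by (intros; apply H; lia).
    assert (Hb : blaschke al k t <> RtoC 0).
    { apply blaschke_neq_0; intros j Hj; apply H; lia. }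
    destruct (H k ltac:(lia)) as [H1 [H2 H3]].
    unfold malmquist_dual, malmquist.
    change (blaschke al (S k) z) with (blaschke al k z * ((z - al k) / (z + al k)))%C.
    change (blaschke al (S k) t) with (blaschke al k t * ((t - al k) / (t + al k)))%C.
    field; repeat split; assumption.
Qed.

Definition malmquist_poly (al : nat -> R) (k m : nat) (d c : nat -> C) (z : C) : C :=
  (csum (fun j => d j * malmquist al j z) k + Defs.poly c m z)%C.

Lemma malmquist_poly_quotient (al : nat -> R) (k m : nat) (d c : nat -> C) :
  exists N, is_poly (k + m) N /\
    forall z, cprod (fun i => z - - al i)%C k <> RtoC 0 ->
      malmquist_poly al k m d c z = (N z / cprod (fun i => z - - al i) k)%C.
Proof.
  assert (H : exists N, is_poly k N /\
    forall z, cprod (fun i => z - - al i)%C k <> RtoC 0 ->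
      csum (fun j => d j * malmquist al j z)%C k = (N z / cprod (fun i => z - - al i) k)%C).
  { induction k as [|k [N [HN E]]].
    - exists (fun _ => RtoC 0); split; [apply is_poly_const|].
      intros z _; simpl; field.
    - exists (fun z => N z * (z - - al k) + d k * cprod (fun i => z - al i) k)%C; split.
      + apply is_poly_plus; [apply is_poly_linear, HN|].
        apply is_poly_scal, (is_poly_le k); [lia|].
        apply (is_poly_ext _ (fun z => 1 * cprod (fun i => z - al i) k)%C); [intros; ring|].
        pose proof (is_poly_cprod 0 (fun _ => RtoC 1) (fun i => RtoC (al i)) k
                      (is_poly_const 1)) as H.
        rewrite Nat.add_0_r in H; exact H.
      + intros z Hz.
        assert (Hk : cprod (fun i => z - - al i)%C k <> RtoC 0).
        { apply cprod_neq_0; intros i Hi.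
          apply (cprod_factor_neq_0 _ (S k) i Hz); lia. }
        assert (Hak : (z - - al k)%C <> RtoC 0)
          by (apply (cprod_factor_neq_0 _ (S k) k Hz); lia).
        simpl; rewrite (E z Hk); unfold malmquist.
        assert (Hb : blaschke al k z = (cprod (fun i => z - al i) k / cprod (fun i => z - - al i) k)%C).
        { clear - Hk; induction k as [|k IH]; unfold blaschke; simpl; [field|].
          assert (H1 : cprod (fun i => z - - al i)%C k <> RtoC 0).
          { apply cprod_neq_0; intros i Hi.
            apply (cprod_factor_neq_0 _ (S k) i Hk); lia. }
          assert (H2 : (z - - al k)%C <> RtoC 0)
            by (apply (cprod_factor_neq_0 _ (S k) k Hk); lia).
          fold (blaschke al k z); rewrite IH by exact H1.
          replace (z + al k)%C with (z - - al k)%C by ring.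
          field; split; assumption. }
        rewrite Hb; replace (z + al k)%C with (z - - al k)%C by ring.
        field; split; assumption. }
  destruct H as [N [HN E]].
  exists (fun z => N z + Defs.poly c m z * cprod (fun i => z - - al i) k)%C; split.
  - apply is_poly_plus; [apply (is_poly_le k); [lia|exact HN]|].
    apply (is_poly_cprod m _ (fun i => - al i)%C); exists c; reflexivity.
  - intros z Hz; unfold malmquist_poly; rewrite (E z Hz); field; exact Hz.
Qed.

Lemma malmquist_poly_rational (al : nat -> R) (k m n : nat) (d c : nat -> C) :
  (forall j, 0 < al j) -> (k + m <= n - 1)%nat ->
  is_rational (n - 1) n (malmquist_poly al k m d c).
Proof.
  intros Hal Hkm.
  destruct (malmquist_poly_quotient al k m d c) as [N [HN E]].
  destruct (is_poly_le _ (n - 1) _ Hkm HN) as [a Ha].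
  pose proof (is_poly_cprod 0 (fun _ => RtoC 1) (fun i => - al i)%C k (is_poly_const 1)) as HB.
  destruct (is_poly_le (k + 0) n _ ltac:(lia) HB) as [b Hb].
  assert (Hb' : forall z, Defs.poly b n z = cprod (fun i => z - - al i)%C k)
    by (intros z; rewrite Hb; ring).
  exists a, b; split.
  - exists (RtoC 1); rewrite Hb'; apply cprod_neq_0; intros i _ E0.
    apply (f_equal fst) in E0; simpl in E0; pose proof (Hal i); lra.
  - intros z; rewrite Hb', Ha; apply E.
Qed.

(** * Estimates on the contour *)

(** Away from 0 the power of |z| is bounded below, so boundedness of f extends the
    local estimate to the whole slit disk. *)
Lemma slit_disk_growth (f : C -> C) (delta : R) :
  0 < delta -> bounded_on (sector PI) f -> bigO_pow_at_0 (sector PI) f delta ->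
  exists M, 0 < M /\ forall w, fst w < 0 -> - PI < snd w < PI ->
    Cmod (f (cexp w)) <= M * exp (delta * fst w).
Proof.
  intros Hd [B HB] [M HM].
  apply locally_C in HM; destruct HM as [eps HM].
  pose proof (cond_pos eps) as He.
  set (K := Rpower eps (- delta)).
  assert (HK : 0 < K) by apply exp_pos.
  exists (Rabs M + Rabs B * K + 1); split.
  { pose proof (Rabs_pos M); pose proof (Rabs_pos B); nra. }
  intros w Hx Hy; pose proof (sector_cexp w Hx Hy) as Hs.
  pose proof (exp_pos (delta * fst w)) as Hep.
  pose proof (Rabs_pos M) as HM0; pose proof (Rabs_pos B) as HB0.
  assert (HBK : 0 <= Rabs B * K) by (apply Rmult_le_pos; lra).
  destruct (Rlt_dec (exp (fst w)) eps) as [h|h].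
  - apply Rle_trans with (Rabs M * exp (delta * fst w)).
    + replace (exp (delta * fst w)) with (Rpower (Cmod (cexp w)) delta)
        by (unfold Rpower; rewrite Cmod_cexp, ln_exp; reflexivity).
      eapply Rle_trans; [apply HM|].
      * change (Cmod (cexp w - 0) < eps).
        replace (cexp w - 0)%C with (cexp w) by ring; rewrite Cmod_cexp; exact h.
      * exact Hs.
      * apply Rmult_le_compat_r; [apply Rlt_le, exp_pos|apply Rle_abs].
    + apply Rmult_le_compat_r; lra.
  - apply Rle_trans with (Rabs B * K * exp (delta * fst w)).
    + assert (1 <= K * exp (delta * fst w)).
      { unfold K, Rpower; rewrite <- exp_plus, <- exp_0.
        apply Rnot_lt_le in h.
        assert (ln eps <= fst w) by (rewrite <- (ln_exp (fst w)); apply ln_le; assumption).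
        destruct (Req_dec (- delta * ln eps + delta * fst w) 0) as [->|]; [lra|].
        apply Rlt_le, exp_increasing; nra. }
      eapply Rle_trans; [apply HB, Hs|].
      pose proof (Rle_abs B); nra.
    + apply Rmult_le_compat_r; lra.
Qed.

(** Any angle strictly between pi / 2 and pi would do; this one has cosine - 1 / 2. *)
Definition psi : R := 2 * (PI / 3).

(** The two rays arg t = + psi and - psi, described through cos psi = - 1 / 2. *)
Definition on_ray (t : C) : Prop := 0 < Cmod t /\ fst t = - Cmod t / 2.

Lemma on_ray_cexp (x y : R) : y = psi \/ y = - psi -> on_ray (cexp (x, y)).
Proof.
  intros Hy; split; rewrite Cmod_cexp; simpl; [apply exp_pos|].
  assert (E : cos y = - 1 / 2).
  { destruct Hy as [->| ->]; [|rewrite cos_neg]; apply cos_2PI3. }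
  rewrite E; field.
Qed.

Lemma Cmod_sqr (z : C) : Cmod z ^ 2 = fst z ^ 2 + snd z ^ 2.
Proof. apply Cmod2_alt. Qed.

Lemma Cmod_le_of_sqr (u v : C) :
  fst u ^ 2 + snd u ^ 2 <= fst v ^ 2 + snd v ^ 2 -> Cmod u <= Cmod v.
Proof.
  rewrite <- !Cmod_sqr; intros H.
  pose proof (Cmod_ge_0 u); pose proof (Cmod_ge_0 v); nra.
Qed.

Lemma on_ray_minus_neq_0 (t : C) (al : R) :
  on_ray t -> 0 < al -> (t - al)%C <> RtoC 0.
Proof.
  intros [H1 H2] Ha E; apply (f_equal fst) in E; simpl in E; lra.
Qed.

Lemma on_ray_plus_neq_0 (t : C) (al : R) : on_ray t -> (t + al)%C <> RtoC 0.
Proof.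
  intros [H1 H2] E; apply (f_equal snd) in E; simpl in E.
  pose proof (Cmod_sqr t) as H3; rewrite H2 in H3.
  assert (snd t = 0) as H4 by lra; rewrite H4 in H3; nra.
Qed.

Lemma right_plus_neq_0 (z : C) (al : R) : 0 < fst z -> 0 < al -> (z + al)%C <> RtoC 0.
Proof. intros H1 H2 E; apply (f_equal fst) in E; simpl in E; lra. Qed.

Lemma on_ray_distance (t z : C) : on_ray t -> 0 < fst z -> Cmod t / 2 <= Cmod (t - z).
Proof.
  intros [H1 H2] Hz.
  pose proof (Rabs_fst_le (t - z)%C) as H; simpl in H.
  rewrite Rabs_left in H; lra.
Qed.

Lemma Cmod_blaschke_right (al : nat -> R) (k : nat) (z : C) :
  (forall j, 0 < al j) -> 0 < fst z -> Cmod (blaschke al k z) <= 1.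
Proof.
  intros Hal Hz; induction k as [|k IH]; unfold blaschke; simpl; [rewrite Cmod_1; lra|].
  fold (blaschke al k z); rewrite Cmod_mult.
  pose proof (right_plus_neq_0 z (al k) Hz (Hal k)) as H0.
  rewrite Cmod_div by exact H0; apply Cmod_gt_0 in H0.
  assert (Cmod (z - al k) / Cmod (z + al k) <= 1).
  { apply Rmult_le_reg_r with (Cmod (z + al k)); [exact H0|].
    unfold Rdiv; rewrite Rmult_assoc, Rinv_l, Rmult_1_r, Rmult_1_l by lra.
    apply Cmod_le_of_sqr; simpl.
    pose proof (Rmult_lt_0_compat _ _ Hz (Hal k)); nra. }
  rewrite <- (Rmult_1_r 1); apply Rmult_le_compat; try assumption; [apply Cmod_ge_0|].
  apply Rdiv_le_0_compat; [apply Cmod_ge_0|exact H0].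
Qed.

Lemma Cmod_cprod_lower (g : nat -> C) (q : R) (J k N : nat) :
  0 <= q -> (J + N <= k)%nat ->
  (forall i, (i < k)%nat -> 1 <= Cmod (g i)) ->
  (forall i, (J <= i < J + N)%nat -> q <= Cmod (g i)) ->
  q ^ N <= Cmod (cprod g k).
Proof.
  intros Hq; revert J N; induction k as [|k IH]; intros J N HN H1 Hqi; simpl.
  - replace N with O by lia; simpl; rewrite Cmod_1; lra.
  - rewrite Cmod_mult; destruct N as [|N'].
    + pose proof (IH O O ltac:(lia) ltac:(auto) ltac:(intros; lia)) as H.
      change (q ^ 0) with 1 in *; pose proof (H1 k ltac:(lia)) as Hk.
      rewrite <- (Rmult_1_r 1); apply Rmult_le_compat; lra.
    + destruct (Nat.eq_dec (J + S N') (S k)) as [E|E].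
      * pose proof (IH J N' ltac:(lia) ltac:(auto) ltac:(intros; apply Hqi; lia)) as H.
        pose proof (Hqi k ltac:(lia)) as Hk.
        replace (q ^ S N') with (q ^ N' * q) by (simpl; ring).
        apply Rmult_le_compat; auto; apply pow_le; exact Hq.
      * pose proof (IH J (S N') ltac:(lia) ltac:(auto) ltac:(intros; apply Hqi; lia)) as H.
        pose proof (H1 k ltac:(lia)) as Hk.
        rewrite <- (Rmult_1_r (q ^ S N')).
        apply Rmult_le_compat; auto; [apply pow_le; exact Hq|lra].
Qed.

Lemma Cmod_factor_on_ray (t : C) (al c : R) :
  on_ray t -> 0 < al -> 0 <= c ->
  c ^ 2 * (Cmod t ^ 2 - al * Cmod t + al ^ 2) <= Cmod t ^ 2 + al * Cmod t + al ^ 2 ->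
  c <= Cmod ((t - al) / (t + al)).
Proof.
  intros Ht Ha Hc H.
  pose proof (on_ray_plus_neq_0 t al Ht) as H0.
  rewrite Cmod_div by exact H0; apply Cmod_gt_0 in H0.
  apply Rmult_le_reg_r with (Cmod (t + al)); [exact H0|].
  unfold Rdiv; rewrite Rmult_assoc, Rinv_l, Rmult_1_r by lra.
  destruct Ht as [H1 H2].
  pose proof (Cmod_sqr t) as Et.
  pose proof (Cmod_sqr (t - al)%C) as Em; pose proof (Cmod_sqr (t + al)%C) as Ep.
  simpl fst in Em, Ep; simpl snd in Em, Ep; rewrite H2 in Et, Em, Ep.
  pose proof (Cmod_ge_0 (t - al)%C).
  apply Rsqr_incr_0_var; [unfold Rsqr|assumption].
  replace (c * Cmod (t + al) * (c * Cmod (t + al))) with (c ^ 2 * Cmod (t + al) ^ 2) by ring.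
  replace (Cmod (t - al) * Cmod (t - al)) with (Cmod (t - al) ^ 2) by ring.
  rewrite Em, Ep.
  set (s := Cmod t) in *.
  replace ((- s / 2 + al) ^ 2 + (snd t + 0) ^ 2) with (s ^ 2 - al * s + al ^ 2) by nra.
  replace ((- s / 2 + - al) ^ 2 + (snd t + - 0) ^ 2) with (s ^ 2 + al * s + al ^ 2) by nra.
  exact H.
Qed.

Lemma exp_quarter_sqr_le_2 : exp (1 / 4) ^ 2 <= 2.
Proof.
  simpl; rewrite Rmult_1_r, <- exp_plus.
  replace (1 / 4 + 1 / 4) with (/ 2) by field.
  assert (H : exp (/ 2) * exp (/ 2) <= 3).
  { rewrite <- exp_plus; replace (/ 2 + / 2) with 1 by field; apply exp_le_3. }
  pose proof (exp_pos (/ 2)); nra.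
Qed.

(** With s = exp x, the nodes between s / 2 and s have their indices in an interval of
    length ln 2 / h >= N, so there are N of them, and L + h + ln 2 <= k h places
    them among the first k.  Each contributes a factor of modulus at
    least sqrt 2 >= exp (1/4); the other factors are harmless. *)
Lemma Cmod_blaschke_on_ray (h L x : R) (k N : nat) (t : C) :
  0 < h -> - L <= x <= 0 -> L + h + ln 2 <= INR k * h -> INR N * h <= ln 2 ->
  on_ray t -> Cmod t = exp x ->
  exp (1 / 4) ^ N <= Cmod (blaschke (fun j => exp (- (INR j * h))) k t).
Proof.
  intros Hh Hx Hk HN Ht Et.
  assert (Hxh : 0 <= - x / h) by (apply Rdiv_le_0_compat; lra).
  destruct (nfloor_ex (- x / h) Hxh) as [J' [HJ1 HJ2]].
  assert (HJ3 : INR J' * h <= - x).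
  { apply Rmult_le_reg_r with (/ h); [apply Rinv_0_lt_compat, Hh|].
    rewrite Rmult_assoc, Rinv_r, Rmult_1_r by lra; exact HJ1. }
  assert (HJ4 : - x < (INR J' + 1) * h).
  { apply Rmult_lt_reg_r with (/ h); [apply Rinv_0_lt_compat, Hh|].
    rewrite Rmult_assoc, Rinv_r, Rmult_1_r by lra; exact HJ2. }
  (* The first index past - x / h: all N indices from there on satisfy
     s / 2 <= alpha_i <= s. *)
  apply (Cmod_cprod_lower _ _ (S J')).
  - apply Rlt_le, exp_pos.
  - assert (INR (S J' + N) <= INR k); [|apply INR_le; assumption].
    rewrite plus_INR, S_INR; apply Rmult_le_reg_r with h; [exact Hh|]; lra.
  - intros i _; apply Cmod_factor_on_ray; [exact Ht|apply exp_pos|lra|].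
    rewrite Et; pose proof (exp_pos x); pose proof (exp_pos (- (INR i * h))); nra.
  - intros i [Hi1 Hi2]; apply Cmod_factor_on_ray; [exact Ht|apply exp_pos|apply Rlt_le, exp_pos|].
    rewrite Et.
    assert (I1 : INR J' + 1 <= INR i) by (rewrite <- S_INR; apply le_INR, Hi1).
    assert (I2 : INR i <= INR J' + INR N).
    { rewrite <- plus_INR; apply le_INR; lia. }
    assert (A1 : exp (- (INR i * h)) <= exp x).
    { apply Rlt_le, exp_increasing; nra. }
    assert (A2 : exp x <= 2 * exp (- (INR i * h))).
    { rewrite <- (exp_ln 2) at 1 by lra; rewrite <- exp_plus.
      destruct (Rle_lt_or_eq_dec x (ln 2 + - (INR i * h))) as [h1|h1]; [nra| |].
      - apply Rlt_le, exp_increasing, h1.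
      - rewrite <- h1; lra. }
    pose proof (exp_pos x) as P1; pose proof (exp_pos (- (INR i * h))) as P2.
    set (s := exp x) in *; set (al := exp (- (INR i * h))) in *.
    pose proof exp_quarter_sqr_le_2 as HE.
    apply Rle_trans with (2 * (s ^ 2 - al * s + al ^ 2)); [apply Rmult_le_compat_r; [nra|exact HE]|].
    nra.
Qed.

Lemma ex_CInt_csum (g : nat -> R -> C) (e : nat -> C) (k : nat) (a b : R) :
  (forall j, (j < k)%nat -> ex_CInt (g j) a b) ->
  ex_CInt (fun x => csum (fun j => g j x * e j)%C k) a b /\
  CInt (fun x => csum (fun j => g j x * e j)%C k) a b
  = csum (fun j => CInt (g j) a b * e j)%C k.
Proof.
  induction k as [|k IH]; intros H; simpl.
  - split; [apply (ex_RInt_const (V := C_R_CompleteNormedModule))|].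
    rewrite CInt_const; ring.
  - destruct IH as [IH1 IH2]; [auto|].
    assert (Hk : ex_CInt (fun x => e k * g k x)%C a b) by (apply ex_CInt_Cmult; auto).
    assert (Hk' : ex_CInt (fun x => g k x * e k)%C a b).
    { revert Hk; apply (ex_RInt_ext (V := C_R_CompleteNormedModule)).
      intros; apply Cmult_comm. }
    split.
    + apply (ex_RInt_plus (V := C_R_CompleteNormedModule)); assumption.
    + rewrite CInt_plus, IH2 by assumption; f_equal.
      rewrite Cmult_comm, <- CInt_Cmult by auto.
      apply (RInt_ext (V := C_R_CompleteNormedModule)); intros; apply Cmult_comm.
Qed.

Lemma is_RInt_exp_scaled (K delta a b : R) :
  0 < delta ->
  is_RInt (fun x => K * exp (delta * x)) a b
    (K * exp (delta * b) / delta - K * exp (delta * a) / delta).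
Proof.
  intros Hd.
  apply (is_RInt_derive (fun x => K * exp (delta * x) / delta)
           (fun x => K * exp (delta * x))).
  - intros x _; auto_derive; [exact I|field; lra].
  - intros x _; apply (ex_derive_continuous (K := R_AbsRing) (V := R_NormedModule)).
    auto_derive; exact I.
Qed.

(** Keeping the weight exp (delta x) inside the integral makes the bound independent
    of [a]: this is what allows truncating the sides of the contour. *)
Lemma Cmod_CInt_exp_le (g : R -> C) (a b K delta : R) :
  0 < delta -> 0 <= K -> a <= b -> ex_CInt g a b ->
  (forall x, a <= x <= b -> Cmod (g x) <= K * exp (delta * x)) ->
  Cmod (CInt g a b) <= K / delta * exp (delta * b).
Proof.
  intros Hd HK Hab Hg H; rewrite <- norm_C_R.
  apply Rle_trans with (K * exp (delta * b) / delta - K * exp (delta * a) / delta).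
  - apply (norm_RInt_le (V := C_R_CompleteNormedModule) g
             (fun x => K * exp (delta * x)) a b _ _ Hab).
    + intros x Hx; rewrite norm_C_R; exact (H x Hx).
    + exact (RInt_correct (V := C_R_CompleteNormedModule) g a b Hg).
    + apply is_RInt_exp_scaled, Hd.
  - assert (0 <= K * exp (delta * a) / delta).
    { apply Rdiv_le_0_compat; [|exact Hd]. apply Rmult_le_pos; [exact HK|apply Rlt_le, exp_pos]. }
    replace (K / delta * exp (delta * b)) with (K * exp (delta * b) / delta) by (field; lra); lra.
Qed.

Lemma poly_csum (c : nat -> C) (m : nat) (z : C) :
  Defs.poly c m z = csum (fun l => c l * z ^ l)%C (S m).
Proof.
  induction m as [|m IH].
  - rewrite poly_0; simpl; ring.
  - rewrite poly_S, IH; reflexivity.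
Qed.

Lemma geometric_csum (v t z : C) (n : nat) :
  t <> RtoC 0 -> (t - z)%C <> RtoC 0 ->
  csum (fun l => (v / t ^ l) * z ^ l)%C n = (v * (t / (t - z)) * (1 - (z / t) ^ n))%C.
Proof.
  intros Ht Hz; induction n as [|n IH]; simpl; [ring|].
  rewrite IH.
  assert (Hp : (t ^ n)%C <> RtoC 0) by (apply Cpow_nz, Ht).
  assert (E : ((z / t) ^ n = z ^ n / t ^ n)%C).
  { unfold Cdiv; rewrite Cpow_mult_l, Cpow_inv by exact Ht; reflexivity. }
  rewrite E; field; repeat split; assumption.
Qed.

(** * The approximant and its error *)

Definition ray_integrand (f : C -> C) (al : nat -> R) (j : nat) (w : C) : C :=
  (f (cexp w) * (cexp w * malmquist_dual al j (cexp w)))%C.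

Definition ray_coef (f : C -> C) (al : nat -> R) (L : R) (j : nat) : C :=
  (/ (RtoC (2 * PI) * Ci) *
   CInt (fun x => ray_integrand f al j (x, (- psi)%R) - ray_integrand f al j (x, psi))
     (- L) (- ln 2))%C.

(** On the arc dt = i t dy, and 1 / (t - z) is expanded in powers of z / t. *)
Definition arc_coef (f : C -> C) (l : nat) : C :=
  (/ (RtoC (2 * PI) * Ci) *
   (Ci * CInt (fun y => f (cexp ((- ln 2)%R, y)) / cexp ((- ln 2)%R, y) ^ l) (- psi) psi))%C.

Definition approximant (f : C -> C) (al : nat -> R) (k m : nat) (L : R) : C -> C :=
  malmquist_poly al k m (ray_coef f al L) (arc_coef f).

Lemma csum_ext (g h : nat -> C) (k : nat) :
  (forall i, (i < k)%nat -> g i = h i) -> csum g k = csum h k.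
Proof.
  induction k as [|k IH]; intros H; simpl; [reflexivity|].
  rewrite IH, H; auto.
Qed.

Lemma csum_scal (c : C) (g : nat -> C) (k : nat) :
  csum (fun i => c * g i)%C k = (c * csum g k)%C.
Proof. induction k as [|k IH]; simpl; [ring|]; rewrite IH; ring. Qed.

Lemma csum_minus (g h : nat -> C) (k : nat) :
  csum (fun i => g i - h i)%C k = (csum g k - csum h k)%C.
Proof. induction k as [|k IH]; simpl; [ring|]; rewrite IH; ring. Qed.

Lemma psi_bounds : PI / 2 < psi < PI.
Proof. unfold psi; pose proof PI_RGT_0; lra. Qed.

Lemma two_pi_i_neq_0 : (RtoC (2 * PI) * Ci)%C <> RtoC 0.
Proof.
  apply Cmod_gt_0; rewrite Cmod_mult, Cmod_Ci, Cmod_R, Rabs_right;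
    pose proof PI_RGT_0; lra.
Qed.

Lemma hol_at_cpow (g : C -> C) (n : nat) (p : C) :
  hol_at g p -> hol_at (fun w => g w ^ n)%C p.
Proof.
  intros H; induction n as [|n IH]; simpl; [apply hol_at_const|].
  apply hol_at_mult; assumption.
Qed.

Lemma hol_at_blaschke (al : nat -> R) (k : nat) (t : C) :
  (forall j, (t + al j)%C <> RtoC 0) -> hol_at (blaschke al k) t.
Proof.
  intros H; apply (hol_at_cprod (fun j z => (z - al j) / (z + al j))%C).
  intros i _; apply hol_at_div; [| |apply H].
  - apply hol_at_minus; [apply hol_at_id|apply hol_at_const].
  - apply hol_at_plus; [apply hol_at_id|apply hol_at_const].
Qed.

Lemma hol_at_ray_integrand (f : C -> C) (al : nat -> R) (j : nat) (x y : R) :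
  holomorphic_on (sector PI) f -> (forall i, 0 < al i) ->
  x < 0 -> y = psi \/ y = - psi -> hol_at (ray_integrand f al j) (x, y).
Proof.
  intros Hf Hal Hx Hy.
  pose proof (on_ray_cexp x y Hy) as Ht; pose proof psi_bounds.
  assert (Hne : forall i, (cexp (x, y) + al i)%C <> RtoC 0)
    by (intros; apply on_ray_plus_neq_0, Ht).
  apply hol_at_mult.
  - apply hol_at_comp; [|apply hol_at_cexp].
    apply (holomorphic_on_hol_at _ _ _ Hf), sector_cexp; simpl; lra.
  - apply hol_at_mult; [apply hol_at_cexp|].
    apply (hol_at_comp (malmquist_dual al j)); [|apply hol_at_cexp].
    apply hol_at_div; [apply hol_at_const| |].
    + apply hol_at_mult; [|apply hol_at_blaschke, Hne].
      apply hol_at_minus; [apply hol_at_id|apply hol_at_const].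
    + apply Cmult_neq_0; [apply on_ray_minus_neq_0; auto|].
      apply blaschke_neq_0; intros i _; split; [apply on_ray_minus_neq_0; auto|apply Hne].
Qed.

(** For z in the right half-plane and t on a ray of the left one, already the real
    parts of t and z are at distance |t| / 2. *)
Lemma on_ray_ratio (t z : C) :
  on_ray t -> 0 < fst z -> (t - z)%C <> RtoC 0 /\ Cmod (t / (t - z)) <= 2.
Proof.
  intros Ht Hz; pose proof (on_ray_distance t z Ht Hz) as H; destruct Ht as [H1 _].
  assert (H0 : (t - z)%C <> RtoC 0) by (apply Cmod_gt_0; lra).
  split; [exact H0|]; rewrite Cmod_div by exact H0.
  apply Rmult_le_reg_r with (Cmod (t - z)); [lra|].
  unfold Rdiv; rewrite Rmult_assoc, Rinv_l, Rmult_1_r by lra; lra.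
Qed.

Section ErrorEstimate.
Variables (f : C -> C) (M delta : R).
Hypothesis Hf : holomorphic_on (sector PI) f.
Hypothesis HM : 0 < M.
Hypothesis Hdelta : 0 < delta.
Hypothesis Hgrowth : forall w, fst w < 0 -> - PI < snd w < PI ->
  Cmod (f (cexp w)) <= M * exp (delta * fst w).
Variables (al : nat -> R) (k m : nat) (L eps : R).
Hypothesis Hal : forall j, 0 < al j.
Hypothesis HL : ln 2 <= L.
Hypothesis Heps : 0 < eps.
Hypothesis Hblaschke : forall t x, - L <= x <= 0 -> on_ray t -> Cmod t = exp x ->
  / eps <= Cmod (blaschke al k t).
Variable w0 : C.
Hypothesis Hw0 : exp (fst w0) <= 1 / 4.
Hypothesis Hw0' : - (PI / 2) < snd w0 < PI / 2.

Let z : C := cexp w0.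
Let G : C -> C := cauchy_kernel f z.
Let a : R := - ln 2.
(* Deep enough that exp (- L') <= |z| / 2, and beyond L. *)
Let L' : R := L + (- fst w0 + ln 2).

Lemma z_right : 0 < fst z.
Proof. apply Rmult_lt_0_compat; [apply exp_pos|apply cos_gt_0; lra]. Qed.

Lemma Cmod_z : Cmod z = exp (fst w0).
Proof. apply Cmod_cexp. Qed.

Lemma exp_a : exp a = 1 / 2.
Proof. unfold a; rewrite exp_Ropp, exp_ln; lra. Qed.

Lemma contour_depths :
  a < 0 /\ - L <= a /\ fst w0 < a /\ - L' < - L /\ - L' < fst w0 /\
  exp (- L') <= Cmod z / 2.
Proof.
  pose proof ln_lt_2.
  assert (fst w0 < a).
  { apply exp_lt_inv; rewrite exp_a; lra. }
  unfold a, L' in *; repeat split; try lra.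
  rewrite Cmod_z.
  replace (exp (fst w0) / 2) with (exp (fst w0) * exp (- ln 2)) by (fold a; rewrite exp_a; field).
  rewrite <- exp_plus.
  destruct (Req_dec L 0); [lra|].
  apply Rlt_le, exp_increasing; lra.
Qed.

Lemma hol_f_cexp x y : x < 0 -> - PI < y < PI -> hol_at (fun w => f (cexp w)) (x, y).
Proof.
  intros Hx Hy; apply hol_at_comp; [|apply hol_at_cexp].
  apply (holomorphic_on_hol_at _ _ _ Hf), sector_cexp; assumption.
Qed.

Lemma hol_G x y :
  x < 0 -> - PI < y < PI -> (cexp (x, y) - z)%C <> RtoC 0 -> hol_at G (x, y).
Proof.
  intros Hx Hy H0; apply hol_at_mult; [apply hol_f_cexp; assumption|].
  apply hol_at_div; [apply hol_at_cexp| |exact H0].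
  apply hol_at_minus; [apply hol_at_cexp|apply hol_at_const].
Qed.

Lemma hol_G_ray x y : x < 0 -> y = psi \/ y = - psi -> hol_at G (x, y).
Proof.
  intros Hx Hy; pose proof psi_bounds; apply hol_G; [exact Hx|lra|].
  apply on_ray_ratio; [apply on_ray_cexp, Hy|apply z_right].
Qed.

Lemma G_ray_le x y :
  x < 0 -> y = psi \/ y = - psi -> Cmod (G (x, y)) <= 2 * M * exp (delta * x).
Proof.
  intros Hx Hy; pose proof psi_bounds; unfold G, cauchy_kernel; rewrite Cmod_mult.
  replace (2 * M * exp (delta * x)) with (M * exp (delta * x) * 2) by ring.
  apply Rmult_le_compat; try apply Cmod_ge_0.
  - apply (Hgrowth (x, y)); simpl; lra.
  - apply on_ray_ratio; [apply on_ray_cexp, Hy|apply z_right].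
Qed.

Lemma arc_ratio y :
  (cexp (a, y) - z)%C <> RtoC 0 /\ Cmod (cexp (a, y) / (cexp (a, y) - z)) <= 2.
Proof.
  set (t := cexp (a, y)).
  assert (Ht : Cmod t = 1 / 2) by (unfold t; rewrite Cmod_cexp; apply exp_a).
  assert (H1 : 1 / 4 <= Cmod (t - z)).
  { pose proof (Cmod_lower (t - z) t (Cmod z)) as H.
    replace (t - z - t)%C with (- z)%C in H by ring.
    rewrite Cmod_opp, Cmod_z in H; lra. }
  assert (H0 : (t - z)%C <> RtoC 0) by (apply Cmod_gt_0; lra).
  split; [exact H0|]; rewrite Cmod_div by exact H0.
  apply Rmult_le_reg_r with (Cmod (t - z)); [lra|].
  unfold Rdiv at 1; rewrite Rmult_assoc, Rinv_l, Rmult_1_r by lra; lra.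
Qed.

Lemma inner_ratio y :
  (cexp ((- L')%R, y) - z)%C <> RtoC 0 /\ Cmod (cexp ((- L')%R, y) / (cexp ((- L')%R, y) - z)) <= 1.
Proof.
  set (t := cexp ((- L')%R, y)).
  assert (Ht : Cmod t <= Cmod z / 2) by (unfold t; rewrite Cmod_cexp; apply contour_depths).
  assert (Hz : 0 < Cmod z) by (rewrite Cmod_z; apply exp_pos).
  assert (H1 : Cmod z - Cmod t <= Cmod (t - z)).
  { pose proof (Cmod_lower (- (t - z)) z (Cmod t)) as H.
    replace (- (t - z) - z)%C with (- t)%C in H by ring.
    rewrite !Cmod_opp in H; lra. }
  assert (H0 : (t - z)%C <> RtoC 0) by (apply Cmod_gt_0; lra).
  split; [exact H0|]; rewrite Cmod_div by exact H0.
  apply Rmult_le_reg_r with (Cmod (t - z)); [lra|].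
  unfold Rdiv; rewrite Rmult_assoc, Rinv_l, Rmult_1_r by lra; lra.
Qed.

Let ray_sum (x : R) : C :=
  csum (fun j => (ray_integrand f al j (x, (- psi)%R) - ray_integrand f al j (x, psi))
                 * malmquist al j z)%C k.

Let arc_sum (y : R) : C :=
  csum (fun l => (f (cexp (a, y)) / cexp (a, y) ^ l) * z ^ l)%C (S m).

Lemma ray_expansion x y :
  y = psi \/ y = - psi ->
  csum (fun j => ray_integrand f al j (x, y) * malmquist al j z)%C k
  = (G (x, y) - G (x, y) * (blaschke al k z / blaschke al k (cexp (x, y))))%C.
Proof.
  intros Hy; pose proof (on_ray_cexp x y Hy) as Ht; set (t := cexp (x, y)) in *.
  destruct (on_ray_ratio t z Ht z_right) as [H0 _].
  rewrite (csum_ext _ (fun j => (f t * t) * (malmquist_dual al j t * malmquist al j z))%C).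
  2: { intros j _; unfold ray_integrand; fold t; ring. }
  rewrite csum_scal, malmquist_expansion; [|intros j _|exact H0].
  - unfold G, cauchy_kernel; fold t.
    assert (blaschke al k t <> RtoC 0).
    { apply blaschke_neq_0; intros j _; split;
        [apply on_ray_minus_neq_0; auto|apply on_ray_plus_neq_0, Ht]. }
    field; split; assumption.
  - split; [apply right_plus_neq_0; [apply z_right|apply Hal]|].
    split; [apply on_ray_minus_neq_0; auto|apply on_ray_plus_neq_0, Ht].
Qed.

Lemma ray_remainder_le x y :
  - L <= x <= a -> y = psi \/ y = - psi ->
  Cmod (G (x, y) - csum (fun j => ray_integrand f al j (x, y) * malmquist al j z)%C k)
  <= 2 * M * eps * exp (delta * x).
Proof.
  intros Hx Hy; rewrite ray_expansion by exact Hy.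
  pose proof (on_ray_cexp x y Hy) as Ht; pose proof contour_depths as [Ha _].
  assert (Et : Cmod (cexp (x, y)) = exp x) by apply Cmod_cexp.
  pose proof (Hblaschke _ x ltac:(lra) Ht Et) as Hb.
  set (t := cexp (x, y)) in *.
  assert (Hp : 0 < / eps) by (apply Rinv_0_lt_compat, Heps).
  assert (Hb0 : blaschke al k t <> RtoC 0) by (apply Cmod_gt_0; lra).
  replace (_ - _)%C with (G (x, y) * (blaschke al k z / blaschke al k t))%C by ring.
  rewrite Cmod_mult, Cmod_div by exact Hb0.
  replace (2 * M * eps * exp (delta * x)) with (2 * M * exp (delta * x) * (1 * eps)) by ring.
  apply Rmult_le_compat; [apply Cmod_ge_0| |apply G_ray_le; lra || exact Hy|].
  - apply Rdiv_le_0_compat; [apply Cmod_ge_0|lra].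
  - apply Rmult_le_compat; [apply Cmod_ge_0|apply Rlt_le, Rinv_0_lt_compat; lra| |].
    + apply Cmod_blaschke_right; [exact Hal|apply z_right].
    + rewrite <- (Rinv_inv eps); apply Rinv_le_contravar; assumption.
Qed.

Lemma arc_remainder_le y :
  - psi <= y <= psi -> Cmod (G (a, y) - arc_sum y) <= M * (1 / 2) ^ m.
Proof.
  intros Hy; destruct (arc_ratio y) as [H0 H2].
  pose proof psi_bounds; pose proof contour_depths as [Ha _].
  pose proof (Hgrowth (a, y) Ha ltac:(simpl; lra)) as Hfg; simpl fst in Hfg.
  unfold arc_sum; rewrite geometric_csum by (apply cexp_neq_0 || exact H0).
  unfold G, cauchy_kernel.
  assert (Et : Cmod (cexp (a, y)) = 1 / 2) by (rewrite Cmod_cexp; apply exp_a).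
  set (t := cexp (a, y)) in *.
  replace (_ - _)%C with (f t * ((t / (t - z)) * (z / t) ^ S m))%C by ring.
  rewrite !Cmod_mult, Cmod_pow.
  assert (Hzt : Cmod (z / t) <= 1 / 2).
  { rewrite Cmod_div by apply cexp_neq_0; rewrite Et, Cmod_z; lra. }
  assert (Hf1 : Cmod (f t) <= M).
  { eapply Rle_trans; [exact Hfg|].
    assert (exp (delta * a) <= 1).
    { rewrite <- exp_0; apply Rlt_le, exp_increasing; nra. }
    nra. }
  assert (Hpow : Cmod (z / t) ^ S m <= (1 / 2) ^ S m)
    by (apply pow_incr; split; [apply Cmod_ge_0|exact Hzt]).
  replace (M * (1 / 2) ^ m) with (M * (2 * (1 / 2) ^ S m)) by (simpl; field).
  assert (Hp0 : 0 <= Cmod (z / t) ^ S m) by (apply pow_le, Cmod_ge_0).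
  apply Rmult_le_compat; [apply Cmod_ge_0| |exact Hf1|].
  - apply Rmult_le_pos; [apply Cmod_ge_0|exact Hp0].
  - apply Rmult_le_compat; [apply Cmod_ge_0|exact Hp0|exact H2|exact Hpow].
Qed.

Lemma approximant_integral :
  (RtoC (2 * PI) * Ci * approximant f al k m L z)%C
  = (CInt ray_sum (- L) a + Ci * CInt arc_sum (- psi) psi)%C
  /\ ex_CInt ray_sum (- L) a /\ ex_CInt arc_sum (- psi) psi.
Proof.
  pose proof contour_depths as [Ha [HLa _]]; pose proof psi_bounds as Hpsi.
  destruct (ex_CInt_csum
    (fun j x => ray_integrand f al j (x, (- psi)%R) - ray_integrand f al j (x, psi))%C
    (fun j => malmquist al j z) k (- L) a) as [R1 R2].
  { intros j _; apply ex_CInt_minus; apply ex_CInt_horizontal; try exact HLa;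
      intros x Hx; apply hol_at_ray_integrand; auto; lra. }
  destruct (ex_CInt_csum (fun l y => f (cexp (a, y)) / cexp (a, y) ^ l)%C
    (fun l => z ^ l)%C (S m) (- psi) psi) as [A1 A2].
  { intros l _; apply (ex_CInt_vertical (fun w => f (cexp w) / cexp w ^ l)%C); [lra|].
    intros y Hy; apply hol_at_div; [apply hol_f_cexp; lra| |].
    - apply hol_at_cpow, hol_at_cexp.
    - apply Cpow_nz, cexp_neq_0. }
  split; [|split; assumption].
  unfold ray_sum, arc_sum; rewrite R2, A2.
  unfold approximant, malmquist_poly; rewrite poly_csum.
  rewrite (csum_ext (fun j => ray_coef f al L j * _)%C
    (fun j => / (RtoC (2 * PI) * Ci) *
      (CInt (fun x => ray_integrand f al j (x, (- psi)%R) - ray_integrand f al j (x, psi))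
        (- L) a * malmquist al j z))%C) by (intros; unfold ray_coef, a; ring).
  rewrite (csum_ext (fun l => arc_coef f l * _)%C
    (fun l => (/ (RtoC (2 * PI) * Ci) * Ci) *
      (CInt (fun y => f (cexp (a, y)) / cexp (a, y) ^ l) (- psi) psi * z ^ l))%C)
    by (intros; unfold arc_coef, a; ring).
  rewrite !csum_scal; pose proof two_pi_i_neq_0 as H0.
  (* Folded so that the field tactic treats 2 pi i as an atom. *)
  set (kappa := (RtoC (2 * PI) * Ci)%C) in *; field; exact H0.
Qed.

(** The error has four parts: the sides with |t| >= exp (- L), the discarded
    sides with exp (- L') <= |t| < exp (- L), the arc |t| = 1/2, and the
    inner arc |t| = exp (- L').  Choosing L' after z keeps z inside the contour
    for every z, however small, without an improper integral. *)
Lemma approximant_error :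
  Cmod (f z - approximant f al k m L z)
  <= (4 * M / delta + 2 * psi * M) * (eps + exp (- (delta * L)) + (1 / 2) ^ m).
Proof.
  pose proof contour_depths as [Ha [HLa [Hwa [HL' [HLw Hin]]]]].
  pose proof psi_bounds as Hpsi; pose proof PI_RGT_0 as HPI; pose proof PI2_3_2 as HPI2.
  destruct approximant_integral as [EA [XR XA]].
  pose proof (cauchy_formula_slit_disk f (- L') a (- psi) psi w0 Hf
    ltac:(lra) ltac:(lra) Ha ltac:(lra) ltac:(lra)) as EC.
  fold z in EC; fold G in EC; unfold rect_int in EC.
  set (U := fun x => (G (x, (- psi)%R) - G (x, psi))%C) in EC.
  assert (XU : forall u v, u <= v -> v <= a -> ex_CInt U u v).
  { intros u v Huv Hv; apply ex_CInt_minus; apply ex_CInt_horizontal; try exact Huv;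
      intros x Hx; apply hol_G_ray; auto; lra. }
  assert (XG1 : ex_CInt (fun y => G (a, y)) (- psi) psi).
  { apply ex_CInt_vertical; [lra|]; intros y Hy; apply hol_G; try lra; apply arc_ratio. }
  assert (XG2 : ex_CInt (fun y => G ((- L')%R, y)) (- psi) psi).
  { apply ex_CInt_vertical; [lra|]; intros y Hy; apply hol_G; try lra; apply inner_ratio. }
  rewrite <- (CInt_Chasles U (- L') (- L) a) in EC by (apply XU; lra).
  rewrite (CInt_minus (fun y => G (a, y)) (fun y => G ((- L')%R, y))) in EC by assumption.
  assert (E : (RtoC (2 * PI) * Ci * (f z - approximant f al k m L z))%C
    = ((CInt (fun x => U x - ray_sum x) (- L) a + CInt U (- L') (- L))
       + (Ci * CInt (fun y => G (a, y) - arc_sum y) (- psi) psi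
          + - (Ci * CInt (fun y => G ((- L')%R, y)) (- psi) psi)))%C).
  { replace (RtoC (2 * PI) * Ci * (f z - approximant f al k m L z))%C
      with (RtoC (2 * PI) * Ci * f z - RtoC (2 * PI) * Ci * approximant f al k m L z)%C by ring.
    rewrite EA, <- EC.
    rewrite (CInt_minus U ray_sum) by (assumption || apply XU; lra).
    rewrite (CInt_minus (fun y => G (a, y)) arc_sum) by assumption.
    ring. }
  assert (B1 : Cmod (CInt (fun x => U x - ray_sum x)%C (- L) a) <= 4 * M / delta * eps).
  { apply Rle_trans with (4 * M * eps / delta * exp (delta * a)).
    - apply Cmod_CInt_exp_le; [exact Hdelta|nra|exact HLa| |].
      + apply ex_CInt_minus; [apply XU; lra|exact XR].
      + intros x Hx; unfold U, ray_sum.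
        rewrite (csum_ext _ (fun j => ray_integrand f al j (x, (- psi)%R) * malmquist al j z
          - ray_integrand f al j (x, psi) * malmquist al j z)%C) by (intros; ring).
        rewrite csum_minus.
        match goal with |- Cmod (?u - ?v - (?s - ?t))%C <= _ =>
          replace (u - v - (s - t))%C with ((u - s) + - (v - t))%C by ring end.
        eapply Rle_trans; [apply Cmod_triangle|]; rewrite Cmod_opp.
        pose proof (ray_remainder_le x (- psi) Hx ltac:(auto)).
        pose proof (ray_remainder_le x psi Hx ltac:(auto)).
        lra.
    - assert (exp (delta * a) <= 1) by (rewrite <- exp_0; apply Rlt_le, exp_increasing; nra).
      replace (4 * M / delta * eps) with (4 * M * eps / delta * 1) by (field; lra).
      apply Rmult_le_compat_l; [|assumption].
      apply Rdiv_le_0_compat; [nra|exact Hdelta]. }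
  assert (B2 : Cmod (CInt U (- L') (- L)) <= 4 * M / delta * exp (- (delta * L))).
  { replace (- (delta * L)) with (delta * - L) by ring.
    apply Cmod_CInt_exp_le; [exact Hdelta|nra|lra|apply XU; lra|].
    intros x Hx; unfold U.
    unfold Cminus; eapply Rle_trans; [apply Cmod_triangle|]; rewrite Cmod_opp.
    pose proof (G_ray_le x (- psi) ltac:(lra) ltac:(auto)).
    pose proof (G_ray_le x psi ltac:(lra) ltac:(auto)).
    lra. }
  assert (B3 : Cmod (CInt (fun y => G (a, y) - arc_sum y)%C (- psi) psi)
               <= (psi - - psi) * (M * (1 / 2) ^ m)).
  { apply Cmod_CInt_le; [lra|apply ex_CInt_minus; assumption|apply arc_remainder_le]. }
  assert (B4 : Cmod (CInt (fun y => G ((- L')%R, y)) (- psi) psi)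
               <= (psi - - psi) * (M * exp (- (delta * L)))).
  { apply Cmod_CInt_le; [lra|assumption|].
    intros y Hy; unfold G, cauchy_kernel; rewrite Cmod_mult.
    rewrite <- (Rmult_1_r (M * exp _)).
    apply Rmult_le_compat; try apply Cmod_ge_0; [|apply inner_ratio].
    eapply Rle_trans; [apply Hgrowth; simpl; lra|]; simpl.
    apply Rmult_le_compat_l; [lra|].
    apply Rlt_le, exp_increasing; nra. }
  assert (T : Cmod (RtoC (2 * PI) * Ci * (f z - approximant f al k m L z))
     <= 4 * M / delta * eps + 4 * M / delta * exp (- (delta * L))
        + ((psi - - psi) * (M * (1 / 2) ^ m) + (psi - - psi) * (M * exp (- (delta * L))))).
  { rewrite E; eapply Rle_trans; [apply Cmod_triangle|].
    apply Rplus_le_compat; (eapply Rle_trans; [apply Cmod_triangle|]);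
      apply Rplus_le_compat; try assumption;
      rewrite ?Cmod_opp, Cmod_mult, Cmod_Ci, Rmult_1_l; assumption. }
  rewrite !Cmod_mult, Cmod_Ci, Cmod_R, Rabs_right, Rmult_1_r in T by lra.
  assert (P1 : 0 < 4 * M / delta) by (apply Rdiv_lt_0_compat; lra).
  assert (P2 : 0 < psi * M) by (apply Rmult_lt_0_compat; lra).
  pose proof (exp_pos (- (delta * L))) as P3.
  assert (P4 : 0 < (1 / 2) ^ m) by (apply pow_lt; lra).
  pose proof (Cmod_ge_0 (f z - approximant f al k m L z)) as P5.
  apply Rle_trans with (2 * PI * Cmod (f z - approximant f al k m L z)); [nra|].
  eapply Rle_trans; [exact T|].
  assert (0 < 4 * M / delta * (1 / 2) ^ m) by (apply Rmult_lt_0_compat; lra).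
  assert (0 < psi * M * eps) by (apply Rmult_lt_0_compat; lra).
  lra.
Qed.
End ErrorEstimate.

(** * Root-exponential convergence *)

Lemma scaled_sector_cexp (theta : R) (z : C) :
  scale_set (1 / 4) (sector theta) z ->
  exists w, z = cexp w /\ exp (fst w) <= 1 / 4 /\ - theta < snd w < theta.
Proof.
  intros [z' [[H1 [t [[H2 [_ H3]] H4]]] ->]].
  apply Cmod_gt_0 in H2.
  exists (ln (Cmod z' / 4), t); simpl fst; simpl snd.
  unfold cexp; simpl fst; simpl snd; rewrite exp_ln by lra.
  split; [|split; [lra|exact H4]].
  rewrite H3 at 1; unfold Cmult, RtoC; simpl; f_equal; field.
Qed.

Definition nodes (sigma : R) (n j : nat) : R := exp (- (INR j * (sigma / sqrt (INR n)))).

(** Half of the admissible degree goes to the rays and half to the arc.  The rays are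
    truncated at half of the depth that the k ~ n / 2 nodes reach,
    namely k sigma / sqrt n ~ sigma sqrt n / 2. *)
Definition root_approximant (f : C -> C) (sigma : R) (n : nat) : C -> C :=
  approximant f (nodes sigma n) ((n - 1) / 2) ((n - 1) / 2) (sigma * sqrt (INR n) / 4).

Lemma half_pred_bound (n : nat) : ((n - 1) / 2 + (n - 1) / 2 <= n - 1)%nat.
Proof. pose proof (Nat.div_mod_eq (n - 1) 2); lia. Qed.

Lemma half_pred_lower (n : nat) : INR n / 2 - 1 <= INR ((n - 1) / 2).
Proof.
  assert (H : (n <= 2 * ((n - 1) / 2) + 2)%nat).
  { pose proof (Nat.div_mod_eq (n - 1) 2).
    pose proof (Nat.mod_upper_bound (n - 1) 2 (Nat.neq_succ_0 1)); lia. }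
  apply le_INR in H; rewrite plus_INR, mult_INR in H.
  change (INR 2) with 2 in H; lra.
Qed.

Lemma root_approximant_poles (f : C -> C) (sigma : R) (n : nat) :
  0 < sigma -> (1 <= n)%nat ->
  simple_poles_only_in
    (fun w => exists j : nat, (j <= n - 1)%nat /\ w = beta sigma n j)
    (root_approximant f sigma n).
Proof.
  intros Hsigma Hn w Hw.
  set (k := ((n - 1) / 2)%nat).
  assert (Hn0 : 0 < sqrt (INR n)) by (apply sqrt_lt_R0, lt_0_INR; lia).
  destruct (malmquist_poly_quotient (nodes sigma n) k k
    (ray_coef f (nodes sigma n) (sigma * sqrt (INR n) / 4)) (arc_coef f)) as [N [HN E]].
  destruct (rational_simple_poles (k + k) k N (root_approximant f sigma n)
    (fun i => - nodes sigma n i)%C HN) with (w := w) as [[j [Hj Ew]] Hs].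
  - intros i j _ _ Hij.
    apply (f_equal fst) in Hij; simpl in Hij; unfold nodes in Hij.
    assert (Hij' : - (INR i * (sigma / sqrt (INR n))) = - (INR j * (sigma / sqrt (INR n))))
      by (apply exp_inv; lra).
    apply INR_eq, (Rmult_eq_reg_r (sigma / sqrt (INR n))); [lra|].
    apply Rgt_not_eq, Rdiv_lt_0_compat; assumption.
  - exact E.
  - exact Hw.
  - split; [|exact Hs].
    exists j; split; [pose proof (half_pred_bound n); fold k in H; lia|].
    rewrite Ew; unfold beta, nodes; rewrite RtoC_opp.
    do 4 f_equal; field; lra.
Qed.

(** The condition on [sqrt n] makes the k nodes reach beyond depth L by a margin of
    h + ln 2. *)
Lemma root_approximant_bound (f : C -> C) (M delta sigma : R) (n : nat) (w : C) :
  holomorphic_on (sector PI) f -> 0 < M -> 0 < delta ->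
  (forall w, fst w < 0 -> - PI < snd w < PI ->
     Cmod (f (cexp w)) <= M * exp (delta * fst w)) ->
  0 < sigma -> 8 + 4 / sigma <= sqrt (INR n) ->
  exp (fst w) <= 1 / 4 -> - (PI / 2) < snd w < PI / 2 ->
  Cmod (f (cexp w) - root_approximant f sigma n (cexp w))
  <= (4 * M / delta + 2 * psi * M) * (exp (1 / 4) + 1 + exp (1 / 2))
     * exp (- (Rmin (delta * sigma / 4) (Rmin (1 / (8 * sigma)) (1 / 4)) * sqrt (INR n))).
Proof.
  intros Hf HM Hd Hg Hs Hn Hw1 Hw2.
  set (s := sqrt (INR n)) in *.
  assert (Hs4 : 0 < 4 / sigma) by (apply Rdiv_lt_0_compat; lra).
  assert (Hss : s * s = INR n) by (apply sqrt_sqrt, pos_INR).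
  set (h := sigma / s).
  assert (Hh : 0 < h) by (apply Rdiv_lt_0_compat; lra).
  pose proof ln_lt_2 as Hl2.
  assert (Hl1 : ln 2 < 1).
  { apply exp_lt_inv; rewrite exp_ln by lra; pose proof (exp_ineq1 1 ltac:(lra)); lra. }
  assert (Hsig : 8 * sigma + 4 <= sigma * s).
  { replace (8 * sigma + 4) with (sigma * (8 + 4 / sigma)) by (field; lra).
    apply Rmult_le_compat_l; lra. }
  set (k := ((n - 1) / 2)%nat).
  pose proof (half_pred_lower n) as Hk; fold k in Hk.
  destruct (nfloor_ex (ln 2 / h)) as [N [HN1 HN2]]; [apply Rdiv_le_0_compat; lra|].
  set (eps := / exp (1 / 4) ^ N).
  assert (Heps : 0 < eps) by (apply Rinv_0_lt_compat, pow_lt, exp_pos).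
  assert (Hhs : h * s = sigma) by (unfold h; field; lra).
  assert (HNh : INR N * h <= ln 2).
  { apply Rmult_le_reg_r with (/ h); [apply Rinv_0_lt_compat, Hh|].
    rewrite Rmult_assoc, Rinv_r, Rmult_1_r by lra; exact HN1. }
  assert (Hhle : h <= sigma).
  { rewrite <- Hhs; nra. }
  assert (Hkh : sigma * s / 4 + h + ln 2 <= INR k * h).
  { apply Rle_trans with ((s * s / 2 - 1) * h).
    - replace ((s * s / 2 - 1) * h) with (h * s * s / 2 - h) by field.
      rewrite Hhs; lra.
    - apply Rmult_le_compat_r; [lra|]; rewrite Hss; exact Hk. }
  pose proof (approximant_error f M delta Hf HM Hd Hg (nodes sigma n) k k
    (sigma * s / 4) eps (fun j => exp_pos _) ltac:(lra) Heps) as HE.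
  specialize (HE ltac:(intros t x Hx Ht Et; unfold eps; rewrite Rinv_inv;
    apply (Cmod_blaschke_on_ray h (sigma * s / 4) x k N t); assumption) w Hw1 Hw2).
  fold (root_approximant f sigma n) in HE.
  eapply Rle_trans; [exact HE|].
  pose proof PI_RGT_0; pose proof psi_bounds.
  assert (HK : 0 <= 4 * M / delta + 2 * psi * M).
  { assert (0 < 4 * M / delta) by (apply Rdiv_lt_0_compat; lra). nra. }
  rewrite (Rmult_assoc (4 * M / delta + 2 * psi * M)).
  apply Rmult_le_compat_l; [exact HK|].
  set (c := Rmin _ _).
  assert (Hc : c <= delta * sigma / 4 /\ c <= 1 / (8 * sigma) /\ c <= 1 / 4).
  { unfold c, Rmin; repeat destruct (Rle_dec _ _); lra. }
  assert (Hexp : forall u v, u <= v -> exp u <= exp v).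
  { intros u v [h1| ->]; [apply Rlt_le, exp_increasing, h1|lra]. }
  assert (Hpow : forall u i, exp u ^ i = exp (INR i * u)).
  { intros u i; induction i as [|i IH]; [simpl; rewrite Rmult_0_l, exp_0; reflexivity|].
    rewrite S_INR; simpl; rewrite IH, <- exp_plus; f_equal; ring. }
  assert (T1 : eps <= exp (1 / 4) * exp (- (c * s))).
  { unfold eps; rewrite Hpow, <- exp_Ropp, <- exp_plus; apply Hexp.
    assert (c * s <= 1 / (8 * sigma) * s) by (apply Rmult_le_compat_r; lra).
    assert (1 / (8 * sigma) * s <= ln 2 / h / 4).
    { replace (ln 2 / h / 4) with (ln 2 * (s / (4 * sigma))) by (unfold h; field; lra).
      replace (1 / (8 * sigma) * s) with (/ 2 * (s / (4 * sigma))) by (field; lra).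
      apply Rmult_le_compat_r; [apply Rdiv_le_0_compat; lra|lra]. }
    lra. }
  assert (T2 : exp (- (delta * (sigma * s / 4))) <= 1 * exp (- (c * s))).
  { rewrite Rmult_1_l; apply Hexp.
    assert (c * s <= delta * sigma / 4 * s) by (apply Rmult_le_compat_r; lra).
    lra. }
  assert (T3 : (1 / 2) ^ k <= exp (1 / 2) * exp (- (c * s))).
  { replace (1 / 2) with (exp (- ln 2)) at 1 by (rewrite exp_Ropp, exp_ln; lra).
    rewrite Hpow, <- exp_plus; apply Hexp.
    assert (c * s <= 1 / 4 * s) by (apply Rmult_le_compat_r; lra).
    assert (s <= INR n) by nra.
    pose proof (pos_INR k).
    assert (INR k * / 2 <= INR k * ln 2) by (apply Rmult_le_compat_l; lra).
    lra. }
  fold s; lra.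
Qed.

Lemma root_approximant_converges (f : C -> C) (delta sigma theta : R) :
  holomorphic_on (sector PI) f -> bounded_on (sector PI) f ->
  0 < delta -> bigO_pow_at_0 (sector PI) f delta -> 0 < sigma -> theta <= PI / 2 ->
  root_exp_convergent (scale_set (1 / 4) (sector theta)) f (root_approximant f sigma).
Proof.
  intros Hf Hb Hd HO Hs Ht.
  destruct (slit_disk_growth f delta Hd Hb HO) as [M [HM Hg]].
  exists (Rmin (delta * sigma / 4) (Rmin (1 / (8 * sigma)) (1 / 4))); split.
  { pose proof (Rmult_lt_0_compat _ _ Hd Hs).
    repeat apply Rmin_pos; apply Rdiv_lt_0_compat; lra. }
  eexists.
  assert (Hs4 : 0 < 4 / sigma) by (apply Rdiv_lt_0_compat; lra).
  destruct (nfloor_ex ((8 + 4 / sigma) ^ 2) ltac:(apply pow2_ge_0)) as [n0 [_ Hn0]].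
  exists (S n0); intros n Hn.
  apply le_INR in Hn; rewrite S_INR in Hn.
  assert (Hsq : 8 + 4 / sigma <= sqrt (INR n)).
  { rewrite <- (sqrt_pow2 (8 + 4 / sigma)) by lra; apply sqrt_le_1_alt; lra. }
  apply Lub_Rbar_correct; intros x [z [Hz ->]].
  destruct (scaled_sector_cexp theta z Hz) as [w [-> [Hw1 Hw2]]].
  apply (root_approximant_bound f M delta sigma n w); try assumption; lra.
Qed.

Theorem theorem2p2 :
  forall theta : R, 0 < theta < PI / 2 ->
  exists rho : R, 0 < rho < 1 /\
  forall f : C -> C,
    holomorphic_on (sector PI) f ->
    bounded_on (sector PI) f ->
    (exists delta : R, 0 < delta /\ bigO_pow_at_0 (sector PI) f delta) ->
    (exists r : nat -> C -> C,
       (forall n : nat, (1 <= n)%nat -> is_rational (n - 1) n (r n)) /\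
       root_exp_convergent (scale_set rho (sector theta)) f r) /\
    (forall sigma : R, 0 < sigma ->
     exists r : nat -> C -> C,
       (forall n : nat, (1 <= n)%nat ->
          is_rational (n - 1) n (r n) /\
          simple_poles_only_in
            (fun w => exists j : nat, (j <= n - 1)%nat /\ w = beta sigma n j)
            (r n)) /\
       root_exp_convergent (scale_set rho (sector theta)) f r).
Proof.
  intros theta Htheta; exists (1 / 4); split; [lra|].
  intros f Hf Hb [delta [Hd HO]].
  assert (Hrat : forall sigma n, is_rational (n - 1) n (root_approximant f sigma n)).
  { intros sigma n; apply malmquist_poly_rational; [intros j; apply exp_pos|apply half_pred_bound]. }
  split.
  - exists (root_approximant f 1); split; [intros n _; apply Hrat|].
    apply (root_approximant_converges f delta); auto; lra.
  - intros sigma Hs; exists (root_approximant f sigma); split.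
    + intros n Hn; split; [apply Hrat|apply root_approximant_poles; assumption].
    + apply (root_approximant_converges f delta); auto; lra.
Qed.
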